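(* Let $m\geq 3$, and let $R_m\in(0,1)$ be the unique root in $(0,1)$ of $$P_{\min}(z)=1-2z^{m-1}-z^m .$$ Then $\rho(G)\geq R_m^{-1}$ for every $G\in\mathcal{SC}_{m+2}(m)$, and $$\min_{G\in\mathcal{SC}_{m+2}(m)}\rho(G)=R_m^{-1}=\rho(\mathcal{C}_m^\times).$$ Moreover, $$2^{\frac{1}{m-1}}<\rho(\mathcal{C}_m^\times)<3^{\frac{1}{m-1}}.$$ If $m\geq 4$, then for $G\in\mathcal{SC}_{m+2}(m)$ the equality $\rho(G)=R_m^{-1}$ holds if and only if $G\cong\mathcal{C}_m^\times$. This isomorphism class is represented by $$(\mathcal{W}^1_m\mathcal{B}_{m-2})_0\text{-}\mathcal{B}^{m-1}_{m,m-1},\qquad (\mathcal{W}^1_{m-1}\mathcal{W}^2_{m-1})_0\text{-}\mathcal{B}^{m-2}_{m-1,m-1},\qquad (\mathcal{B}_2\mathcal{W}^1_m)_0\text{-}\mathcal{B}^{m-1}_{m,m-1},$$ all of which are isomorphic to $\mathcal{C}_m^\times$. If $m=3$, then for $G\in\mathcal{SC}_5(3)$ the equality $\rho(G)=R_3^{-1}$ holds if and only if $G$ is isomorphic to one of the two digraphs $\mathcal{C}_3^\times$ and $(\mathcal{W}^1_2\mathcal{W}^1_3)^-_0\text{-}\mathcal{B}^1_{3,1}$. Both have spectral radius $$\rho(\mathcal{C}_3^\times)=\rho\left((\mathcal{W}^1_2\mathcal{W}^1_3)^-_0\text{-}\mathcal{B}^1_{3,1}\right)=\frac{1+\sqrt5}{2},$$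 but $(\mathcal{W}^1_2\mathcal{W}^1_3)^-_0\text{-}\mathcal{B}^1_{3,1}\not\cong\mathcal{C}_3^\times$.
   Context: Digraphs are finite; loops are allowed, multiple edges are not. For positive integers $m$ and $q\ge m$, $\mathcal{SC}_q(m)$ is the class of strongly connected digraphs with exactly $m$ vertices and exactly $q$ edges. $\rho(G)$ is the spectral radius of the adjacency matrix of $G$, and $\cong$ denotes digraph isomorphism. Cross-chorded cycle: for $m\ge 3$, $\mathcal{C}_m^\times$ has vertex set $\{v_1,\dots,v_m\}$ and edge set $\{(v_k,v_{k+1}):1\le k\le m-1\}\cup\{(v_m,v_1),(v_1,v_3),(v_2,v_4)\}$, indices being understood cyclically ($v_{m+r}=v_r$). Butterfly digraph: for positive integers $k_1,k_2,t$ with $1\le t\le\min\{k_1,k_2\}$, $\mathcal{B}^{\,t}_{k_1,k_2}$ is the strongly connected digraph with $k_1+k_2-t$ vertices and $k_1+k_2-t+1$ edges that contains two distinct directed simple cycles with $k_1$ and $k_2$ vertices sharing exactly $t$ vertices. Its vertices are labelled $h_1$ (head, region $\mathcal{H}$), $b_2,\dots,b_t$ (body, region $\mathcal{B}$), and $w^s_{t+1},\dots,w^s_{k_s}$ (wing, region $\mathcal{W}^s$) for $s=1,2$, so that the $s$-th cycle is $h_1\to w^s_{k_s}\to w^s_{k_s-1}\to\cdots\to w^s_{t+1}\to b_t\to\cdots\to b_2\to h_1$ (empty parts are skipped; if $k_s=t=1$ the $s$-th cycle is a loop at $h_1$). Inserting an ear of length $l\ge0$ from a vertex $u$ to a vertex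 $v$ means adding $l$ new vertices $e_1,\dots,e_l$ and the $l+1$ edges of the path $u\to e_1\to\cdots\to e_l\to v$ (for $l=0$, the single edge $u\to v$). For regions $\mathcal{X},\mathcal{Y}$ and vertices $x_i\in\mathcal{X}$, $y_j\in\mathcal{Y}$, the symbol $(\mathcal{X}_i\mathcal{Y}_j)_l\text{-}\mathcal{B}^{\,t}_{k_1,k_2}$ denotes the digraph obtained from $\mathcal{B}^{\,t}_{k_1,k_2}$ by inserting an ear of length $l$ from $x_i$ to $y_j$. When $\mathcal{X}=\mathcal{Y}$, a superscript $-$ indicates $i<j$ (the ear goes against the direction of the edges of the region). *)

(* Defs.v *)
From HB Require Import structures.
From mathcomp Require Import all_boot all_order all_algebra.
From mathcomp Require Import complex.
From mathcomp Require Import boolp classical_sets reals exp.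

Set Implicit Arguments.
Unset Strict Implicit.
Unset Printing Implicit Defensive.

Import GRing.Theory Num.Theory.

Local Open Scope ring_scope.

(* Finite digraphs: [rel] permits loops and excludes multiple edges. *)
Record digraph := Digraph { vertex :> finType; edge : rel vertex }.

Definition edges (G : digraph) : {set G * G} := [set p | edge p.1 p.2].

Definition strongly_connected (G : digraph) : Prop :=
  forall x y : G, connect (@edge G) x y.

(* The class SC_q(m). *)
Definition SC (q m : nat) (G : digraph) : Prop :=
  [/\ #|G| = m, #|edges G| = q & strongly_connected G].

Definition digraph_iso (G H : digraph) : Prop :=
  exists f : G -> H, bijective f /\ forall x y, edge (f x) (f y) = edge x y.

Definition adjacency_mx (R : pzSemiRingType) (G : digraph) : 'M[R]_#|G| :=
  \matrix_(i, j) (edge (enum_val i) (enum_val j))%:R.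

(* The set of moduli of the complex eigenvalues is finite, and nonempty when
   the matrix has positive size, so that this supremum is then a maximum. *)
Definition spectral_radius (R : realType) (n : nat) (A : 'M[R]_n) : R :=
  sup [set ComplexField.Normc.normc l | l in
        [set l : R[i] | eigenvalue (map_mx (real_complex R) A) l]]%classic.

Definition rho (R : realType) (G : digraph) : R :=
  spectral_radius (adjacency_mx R G).

Definition is_min_rho (R : realType) (C : digraph -> Prop) (r : R) : Prop :=
  (exists G, C G /\ rho R G = r) /\ forall G, C G -> r <= rho R G.

(* A digraph presented by the list of the names of its vertices and the list
   of its edges; repetitions in either list are irrelevant. *)
Record presentation (L : Type) := Presentation {
  labels : seq L;
  arcs : seq (L * L)
}.

Definition digraph_of (L : choiceType) (P : presentation L) : digraph :=
  @Digraph (seq_sub (labels P)) (fun x y => (val x, val y) \in arcs P).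

Definition steps (L : Type) (p : seq L) : seq (L * L) := zip p (behead p).

(* The edges of the directed cycle through x and then the elements of p; if p
   is empty, this is a loop at x. *)
Definition cycle_arcs (L : Type) (x : L) (p : seq L) : seq (L * L) :=
  steps (x :: rcons p x).

(* New vertices are named [inr 1], ..., [inr l]. *)
Definition insert_ear (L : Type) (l : nat) (u v : L) (P : presentation L) :
    presentation (L + nat) :=
  Presentation
    (map inl (labels P) ++ map inr (iota 1 l))
    ([seq (inl a.1, inl a.2) | a <- arcs P] ++
     steps (inl u :: rcons (map inr (iota 1 l)) (inl v))).

(* [cyc m k] is the representative of k modulo m in {1, ..., m}. *)
Definition cyc (m k : nat) : nat := (k.-1 %% m).+1.

(* v_k is named k. *)
Definition cross_chorded (m : nat) : digraph :=
  digraph_of (Presentation (iota 1 m)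
    ([seq (k, k.+1) | k <- iota 1 m.-1] ++
     [:: (m, 1%N); (cyc m 1, cyc m 3); (cyc m 2, cyc m 4)])).

(* [Wing false] and [Wing true] are the regions W^1 and W^2. *)
Inductive region := Head | Body | Wing of bool.

Notation W1 := (Wing false).
Notation W2 := (Wing true).

Definition region_code (X : region) : option (option bool) :=
  match X with
  | Head => None | Body => Some None | Wing s => Some (Some s)
  end.

Definition region_decode (c : option (option bool)) : region :=
  match c with
  | None => Head | Some None => Body | Some (Some s) => Wing s
  end.

Lemma region_codeK : cancel region_code region_decode.
Proof. by case. Qed.

HB.instance Definition _ := Countable.copy region (can_type region_codeK).

(* (Head, 1), (Body, i), (Wing s, i) stand for h_1, b_i, w^s_i. *)
Definition butterfly_label : choiceType := (region * nat)%type.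

Definition hd1 : butterfly_label := (Head, 1%N).

Definition body (t : nat) : seq butterfly_label :=
  [seq (Body, i) | i <- rev (iota 2 t.-1)].

Definition wing (s : bool) (k t : nat) : seq butterfly_label :=
  [seq (Wing s, i) | i <- rev (iota t.+1 (k - t))].

(* Meaningful for 1 <= t <= min(k1, k2), excluding k1 = k2 = t, for which the
   two cycles coincide. *)
Definition butterfly (k1 k2 t : nat) : presentation butterfly_label :=
  Presentation
    (hd1 :: wing false k1 t ++ wing true k2 t ++ body t)
    (cycle_arcs hd1 (wing false k1 t ++ body t) ++
     cycle_arcs hd1 (wing true k2 t ++ body t)).

(* (X_i Y_j)_l - B^t_{k1,k2}; the superscript "-" carries no information
   beyond X = Y and i < j. *)
Definition eared_butterfly (X : region) (i : nat) (Y : region) (j l : nat)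
    (k1 k2 t : nat) : digraph :=
  digraph_of (insert_ear l (X, i) (Y, j) (butterfly k1 k2 t)).

Definition Pmin (R : realType) (m : nat) : {poly R} :=
  1 - 2 *: 'X^(m.-1) - 'X^m.

(* Main.v *)
Require Import Defs.
From mathcomp Require Import all_boot all_order all_algebra.
From mathcomp Require Import complex polyrcf.
From mathcomp Require Import boolp.
From mathcomp Require Import reals exp.
From mathcomp Require Import zify ring lra.

Import Order.TTheory GRing.Theory Num.Theory.

Local Open Scope ring_scope.

(* Let z = R_m and let y be a positive function on the vertices with
   y <= z A y.  Collatz-Wielandt gives rho(G) >= 1/z, with strict inequality if
   the inequality is strict somewhere, since G is strongly connected.

   As the out-degrees exceed 1 by a total of 2, either one vertex u has
   out-degree 3 or two vertices u, v have out-degree 2, and all other vertices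
   have out-degree 1.  From such a vertex x one is led along a unique path, of
   length d(x), to the first branching vertex t(x), so one takes
   y(x) = z^d(x) c(t(x)), and only the inequalities at the branching vertices
   have to be checked.  Write p and q for the numbers of vertices led to u and to
   v; p + q = m.  Distinct successors of one vertex that are led to u have d-values
   dominated by p-1, p-2, ..., whence lower bounds for the sums:
   - one branching vertex: z^m + z^(m-1) + z^(m-2) > 1;
   - v has no return to itself: z^p + z^m + z^(m-1) >= 1 (or more than 1, if u has
     none either), with equality only for C_m^x;
   - u and v both have a return to themselves: z^p + z^q >= 1, with equality only for
     m = 3 and the second extremal digraph. *)

(** * Collatz-Wielandt bounds *)

Section PerronFrobenius.
Set Implicit Arguments.
Unset Strict Implicit.
Variables (R : realType) (n : nat) (A : 'M[R]_n).
Hypothesis A_ge0 : forall i j, 0 <= A i j.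

(* The row w(t) = 1^T adj(tI - A) satisfies w(t) (tI - A) = chi(t) 1^T.  If chi > 0
   on [t, oo), then w > 0 there: w > 0 for large t, and at the largest zero of an
   entry of w the others are nonnegative, which contradicts the equation. *)
Definition adj_colsum (j : 'I_n) : {poly R} := \sum_i (\adj (char_poly_mx A)) i j.

Lemma adj_colsumE t j :
  t * (adj_colsum j).[t] = \sum_i (adj_colsum i).[t] * A i j + (char_poly A).[t].
Proof.
have := mul_adj_mx (char_poly_mx A).
move/(congr1 (fun M : 'M[{poly R}]_n => (\sum_i M i j).[t])).
rewrite (eq_bigr (fun i => \sum_k (\adj (char_poly_mx A)) i k * (char_poly_mx A) k j));
  last by move=> i _; rewrite mxE.
rewrite exchange_big /=.
rewrite (eq_bigr (fun k => adj_colsum k * (char_poly_mx A) k j)); last first.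
  by move=> k _; rewrite /adj_colsum mulr_suml.
rewrite [in RHS](bigD1 j) //= !mxE eqxx mulr1n [X in _ + X]big1 ?addr0; last first.
  by move=> i /negPf ij; rewrite mxE ij.
move=> <-; rewrite [X in _ + X]horner_sum.
rewrite [X in _ + X](eq_bigr (fun k =>
    (k == j)%:R * (t * (adj_colsum j).[t]) - (adj_colsum k).[t] * A k j)).
  rewrite big_split /= sumrN [X in _ + (X - _)](bigD1 j) //= eqxx mul1r.
  rewrite [X in _ + (_ + X - _)]big1 ?addr0; last first.
    by move=> i /negPf ->; rewrite mul0r.
  by rewrite addrC subrK.
move=> k _; rewrite !mxE hornerM; have [->|kj] := eqVneq k j.
  by rewrite mulr1n hornerD hornerN hornerX hornerC [true%:R]mulr1n; ring.
by rewrite mulr0n hornerD hornerN !hornerC [false%:R]mulr0n; ring.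
Qed.

(** The equation is read at the index [i] of the smallest entry [w_i]. If [w_i <= 0], its sum is at
    least [w_i] times a column sum of [A] that is below [t], hence at least [t w_i], leaving no room
    for [chi(t) > 0]. *)
Lemma adj_colsum_large t j : (forall s, t <= s -> 0 < (char_poly A).[s]) ->
  \sum_i \sum_k A i k < t -> 0 < (adj_colsum j).[t].
Proof.
move=> chi_gt0 tA.
case: (arg_minP (fun k => (adj_colsum k).[t]) (isT : xpredT j)) => i _ imin.
apply: lt_le_trans (imin j isT); rewrite ltNge; apply/negP => wi_le0.
have := adj_colsumE t i.
have : \sum_k (adj_colsum k).[t] * A k i >= (adj_colsum i).[t] * \sum_k A k i.
  rewrite mulr_sumr; apply: ler_sum => k _; apply: ler_wpM2r => //; exact: imin.
have : \sum_k A k i <= \sum_i \sum_k A i k.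
  rewrite [leRHS]exchange_big /= [leRHS](bigD1 i) //= lerDl.
  by apply: sumr_ge0 => k _; apply: sumr_ge0.
have := chi_gt0 t (lexx t); nra.
Qed.

Lemma adj_colsum_gt0 t j : (forall s, t <= s -> 0 < (char_poly A).[s]) ->
  0 < (adj_colsum j).[t].
Proof.
move=> chi_gt0; pose T := Num.max t (\sum_i \sum_k A i k) + 1.
have tT : t < T by rewrite /T ltr_pwDr // le_max lexx.
have chiT s : T <= s -> 0 < (char_poly A).[s].
  by move=> Ts; apply: chi_gt0; apply: le_trans Ts; exact: ltW.
have wT k : 0 < (adj_colsum k).[T].
  by apply: adj_colsum_large => //; rewrite /T ltr_pwDr // le_max lexx orbT.
(* Every zero of an entry of [w] is a root of [P], so the largest zero can be searched for in a
   single polynomial. *)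
pose P := \prod_k adj_colsum k.
have PT : P.[T] != 0.
  rewrite /P horner_prod; apply/prodf_neq0 => k _; exact: lt0r_neq0.
have rootP k s : root (adj_colsum k) s -> root P s.
  by move=> /eqP r; rewrite rootE /P horner_prod (bigD1 k) //= r mul0r.
have pos_above y : t <= y <= T -> {in `]y, T[, forall s, ~~ root P s} ->
    forall k s, y < s -> s <= T -> 0 < (adj_colsum k).[s].
  move=> ytT noroot k s ys sT; rewrite ltNge; apply/negP => ws.
  have [|r] := polyrcf.poly_ivt (p := adj_colsum k) sT; first by rewrite pmulr_lle0.
  rewrite in_itv /= => /andP[sr rT] rr.
  move: rT; rewrite le_eqVlt => /orP[/eqP rT|rT].
    by move: rr; rewrite rT rootE (gt_eqF (wT k)).
  have := noroot r; rewrite in_itv /= rT (lt_le_trans ys sr) => /(_ isT).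
  by rewrite (rootP k).
(* [prev_root] returns the largest root of [P] in the open interval, or [t - 1] if there is none;
   starting below [t] also catches a zero at [t] itself. If it is below [t], a sign change on
   [[t, T]] is impossible. *)
have [le_t|lt_t] := leP t (prev_root P (t - 1) T); last first.
  rewrite ltNge; apply/negP => wt.
  have [|r] := polyrcf.poly_ivt (p := adj_colsum j) (ltW tT); first by rewrite pmulr_lle0.
  rewrite in_itv /= => /andP[tr]; rewrite le_eqVlt => /orP[/eqP->|rT] rr.
    by move: rr; rewrite rootE (gt_eqF (wT j)).
  have := @prev_noroot _ P (t - 1) T r.
  rewrite in_itv /= rT (lt_le_trans lt_t tr) => /(_ isT)/negP; apply.
  exact: (rootP j).
have t1T : t - 1 < T by apply: lt_trans tT; rewrite ltrBlDr ltrDl.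
move: le_t; case: prev_rootP => [P0|y _ Py yin noroot ty|c _ -> _]; last first.
- by rewrite min_l ?(ltW t1T) // lerBrDr gerDl ler10.
- exfalso; have yT : y < T by move: yin; rewrite in_itv => /andP[].
  have wy_ge0 k : 0 <= (adj_colsum k).[y].
    rewrite leNgt; apply/negP => wy.
    have [|r] := polyrcf.poly_ivtoo (p := adj_colsum k) (ltW yT).
      by rewrite nmulr_rlt0.
    move=> rin rr; have /negP := noroot r rin; apply; exact: (rootP k).
  move: Py; rewrite /P horner_prod => /eqP/prodf_eq0[k _ /eqP wk].
  have := adj_colsumE y k; rewrite wk mulr0.
  have := chi_gt0 y ty.
  have : 0 <= \sum_i (adj_colsum i).[y] * A i k.
    by apply: sumr_ge0 => i _; rewrite mulr_ge0.
  lra.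
- by move: PT; rewrite P0 horner0 eqxx.
Qed.

(** Without such a root the monic [chi] is positive on [[lambda, oo)], hence so is [w]. Pairing
    [w(lambda)] with [lambda y <= A y] then gives [chi(lambda) \sum y <= 0], a contradiction. *)
Lemma char_poly_root_ge (y : 'I_n -> R) lambda :
  (forall i, 0 <= y i) -> (exists i, 0 < y i) ->
  (forall i, lambda * y i <= \sum_j A i j * y j) ->
  exists2 t, lambda <= t & root (char_poly A) t.
Proof.
move=> y_ge0 [i0 yi0] lam_y; apply: contrapT => noroot.
have chi_gt0 s : lambda <= s -> 0 < (char_poly A).[s].
  move=> ls; rewrite -sgr_cp0 (@sgp_pinftyP _ lambda) ?in_itv /= ?ls //.
    by rewrite /sgp_pinfty (monicP (char_poly_monic A)) sgr1.
  move=> x; rewrite in_itv /= andbT => lx; apply/negP => rx.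
  by apply: noroot; exists x.
have w_gt0 j := adj_colsum_gt0 j chi_gt0.
have : \sum_i (adj_colsum i).[lambda] * (lambda * y i) <=
       \sum_i (adj_colsum i).[lambda] * \sum_j A i j * y j.
  by apply: ler_sum => i _; rewrite ler_pM2l.
rewrite leNgt => /negP; apply.
have -> : \sum_i (adj_colsum i).[lambda] * (lambda * y i) =
    \sum_j (\sum_i (adj_colsum i).[lambda] * A i j) * y j +
    (char_poly A).[lambda] * \sum_j y j.
  rewrite mulr_sumr -big_split /=; apply: eq_bigr => i _.
  by rewrite -mulrDl -adj_colsumE; ring.
have -> : \sum_i (adj_colsum i).[lambda] * \sum_j A i j * y j =
    \sum_j (\sum_i (adj_colsum i).[lambda] * A i j) * y j.
  under eq_bigr do rewrite mulr_sumr.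
  rewrite exchange_big /=; apply: eq_bigr => j _; rewrite mulr_suml.
  by apply: eq_bigr => i _; rewrite mulrA.
rewrite ltrDl mulr_gt0 ?chi_gt0 // (bigD1 i0) //= ltr_wpDr //.
exact: sumr_ge0.
Qed.

(** The moduli [a] of a left eigenvector satisfy [|l| a <= a A] by the triangle inequality. Pairing
    with [y] gives [|l| (a y) <= a A y <= mu (a y)], and [a y > 0]. *)
Lemma normc_eigenvalue_le (y : 'I_n -> R) mu (l : R[i]) :
  (forall i, 0 < y i) -> (forall i, \sum_j A i j * y j <= mu * y i) ->
  eigenvalue (map_mx (real_complex R) A) l -> ComplexField.Normc.normc l <= mu.
Proof.
move=> y_gt0 Ay /eigenvalueP[v vA v_neq0].
pose a i := ComplexField.Normc.normc (v 0 i).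
have a_ge0 i : 0 <= a i by rewrite /a; case: (v 0 i) => x z; exact: sqrtr_ge0.
have step j : ComplexField.Normc.normc l * a j <= \sum_i a i * A i j.
  rewrite /a -ComplexField.Normc.normcM.
  have -> : l * v 0 j = \sum_i v 0 i * (A i j)%:C%C.
    have /matrixP/(_ 0 j) := vA; rewrite !mxE => <-.
    by apply: eq_bigr => i _; rewrite mxE.
  apply: (@big_ind2 _ _ (fun (x : R[i]) r => ComplexField.Normc.normc x <= r)).
  - by rewrite ComplexField.Normc.normc0.
  - move=> x1 x2 y1 y2 h1 h2; apply: le_trans (lerD h1 h2); exact: le_normcD.
  - move=> i _; rewrite ComplexField.Normc.normcM /= expr0n /= addr0 sqrtr_sqr.
    by rewrite ger0_norm.
have Sgt0 : 0 < \sum_j a j * y j.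
  rewrite lt_neqAle eq_sym sumr_ge0 ?andbT; last first.
    by move=> j _; rewrite mulr_ge0 // ltW.
  apply: contra v_neq0; rewrite psumr_eq0; last first.
    by move=> j _; rewrite mulr_ge0 // ltW.
  move=> /allP a0; apply/eqP/rowP => j; rewrite mxE.
  apply: ComplexField.Normc.eq0_normc.
  have := a0 j (mem_index_enum j).
  by rewrite mulf_eq0 (gt_eqF (y_gt0 j)) orbF => /eqP.
rewrite -(ler_pM2r Sgt0) mulr_sumr.
apply: (@le_trans _ _ (\sum_j (\sum_i a i * A i j) * y j)).
  by apply: ler_sum => j _; rewrite mulrA ler_pM2r.
rewrite mulr_sumr.
have -> : \sum_j (\sum_i a i * A i j) * y j = \sum_i a i * (\sum_j A i j * y j).
  under [RHS]eq_bigr do rewrite mulr_sumr.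
  rewrite exchange_big /=; apply: eq_bigr => j _; rewrite mulr_suml.
  by apply: eq_bigr => i _; rewrite mulrA.
apply: ler_sum => i _; rewrite mulrCA; exact: ler_wpM2l.
Qed.

Lemma real_root_le_spectral_radius t :
  root (char_poly A) t -> t <= spectral_radius A.
Proof.
move=> rt; apply: (@le_trans _ _ (ComplexField.Normc.normc t%:C%C)).
  by rewrite /= expr0n addr0 sqrtr_sqr ler_norm.
apply: ub_le_sup; last first.
  exists t%:C%C => //=; rewrite eigenvalue_root_char -map_char_poly.
  by rewrite fmorph_root.
(* The supremum requires a bounded set; with the constant vector, the sum of all entries bounds
   every modulus. *)
exists (\sum_i \sum_j A i j) => _ [l /= el <-].
apply: (@normc_eigenvalue_le (fun=> 1)) el => //= i; rewrite mulr1.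
under [leLHS]eq_bigr do rewrite mulr1.
rewrite [leRHS](bigD1 i) //= lerDl; apply: sumr_ge0 => k _; exact: sumr_ge0.
Qed.

Lemma spectral_radius_ge (y : 'I_n -> R) lambda :
  (forall i, 0 <= y i) -> (exists i, 0 < y i) ->
  (forall i, lambda * y i <= \sum_j A i j * y j) -> lambda <= spectral_radius A.
Proof.
move=> y_ge0 y_gt0 /(char_poly_root_ge y_ge0 y_gt0)[t lt rt].
exact: le_trans lt (real_root_le_spectral_radius rt).
Qed.

Lemma spectral_radius_eq (y : 'I_n -> R) lambda : (0 < n)%N ->
  (forall i, 0 < y i) -> (forall i, \sum_j A i j * y j = lambda * y i) ->
  spectral_radius A = lambda.
Proof.
move=> n_gt0 y_gt0 Ay; have y_ge0 i := ltW (y_gt0 i).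
have Ay_ge i : lambda * y i <= \sum_j A i j * y j by rewrite Ay.
have ex : exists i, 0 < y i by exists (Ordinal n_gt0).
apply/eqP; rewrite eq_le (spectral_radius_ge y_ge0) // andbT.
have [t lt rt] := char_poly_root_ge y_ge0 ex Ay_ge.
apply: ge_sup.
  exists (ComplexField.Normc.normc t%:C%C), t%:C%C => //=.
  by rewrite eigenvalue_root_char -map_char_poly fmorph_root.
move=> _ [l /= el <-]; apply: normc_eigenvalue_le el => // i.
by rewrite Ay.
Qed.

End PerronFrobenius.

Lemma connect_invariant (T : finType) (e : rel T) (P : pred T) x y :
  (forall u v, P u -> e u v -> P v) -> connect e x y -> P x -> P y.
Proof.
move=> Pe /connectP[p ep ->]; elim: p x ep => //= v p IHp x /andP[xv vp] Px.
by apply: IHp vp _; exact: Pe xv.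
Qed.

(** * Collatz-Wielandt bounds for digraphs *)

Section PerronDigraph.
Set Implicit Arguments.
Unset Strict Implicit.
Variables (R : realType) (G : digraph).
Implicit Types (y : G -> R) (lambda : R).

Definition out_sum y (x : G) : R := \sum_(w | edge x w) y w.

Lemma adjacency_out_sum y i :
  \sum_j (adjacency_mx R G) i j * y (enum_val j) = out_sum y (enum_val i).
Proof.
rewrite /out_sum [RHS]big_mkcond (reindex (@enum_val G predT)) /=; last first.
  by apply: onW_bij; exact: enum_val_bij.
apply: eq_bigr => j _; rewrite mxE.
by case: ifP => _; rewrite ?mul1r ?mul0r.
Qed.

Lemma adjacency_ge0 i j : 0 <= (adjacency_mx R G) i j.
Proof. by rewrite mxE. Qed.

Lemma rho_ge y lambda : (forall x, 0 <= y x) -> (exists x, 0 < y x) ->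
  (forall x, lambda * y x <= out_sum y x) -> lambda <= rho R G.
Proof.
move=> y_ge0 [x yx] Ay.
apply: (spectral_radius_ge adjacency_ge0 (y := fun i => y (enum_val i))) => //.
  by exists (enum_rank x); rewrite enum_rankK.
by move=> i; rewrite adjacency_out_sum.
Qed.

Lemma rho_eq y lambda : (0 < #|G|)%N -> (forall x, 0 < y x) ->
  (forall x, out_sum y x = lambda * y x) -> rho R G = lambda.
Proof.
move=> G_gt0 y_gt0 Ay.
apply: (spectral_radius_eq adjacency_ge0 (y := fun i => y (enum_val i))) => //.
by move=> i; rewrite adjacency_out_sum.
Qed.

(* Replacing y by y + A y propagates strictness to the predecessors of the
   vertices at which the inequality is already strict. *)
Lemma rho_gt y lambda : strongly_connected G -> 0 <= lambda ->
  (forall x, 0 < y x) -> (forall x, lambda * y x <= out_sum y x) ->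
  (exists x, lambda * y x < out_sum y x) -> lambda < rho R G.
Proof.
move=> Gsc lam_ge0.
have [k] := ubnP #|[set x | lambda * y x == out_sum y x]|.
elim: k y => // k IHk y /ltnSE le_k y_gt0 Ay [x0 Ax0].
(* If the inequality is strict everywhere, the minimum of the ratios [out_sum y x / y x] exceeds
   [lambda] and is itself a lower bound. *)
have [all_strict|] := boolP [forall x, lambda * y x < out_sum y x].
  case: (arg_minP (fun x => out_sum y x / y x) (isT : xpredT x0)) => x _ xmin.
  apply: (@lt_le_trans _ _ (out_sum y x / y x)).
    by rewrite ltr_pdivlMr //; exact: (forallP all_strict).
  apply: (@rho_ge y) => [z||z]; first exact: ltW.
  - by exists x0.
  - by rewrite -ler_pdivlMr //; exact: xmin.
rewrite negb_forall => /existsP[x1]; rewrite -leNgt => Ax1.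
(* An edge must lead from the set of equality to its complement; otherwise equality would spread
   from [x1] to [x0]. *)
have [[x [z [xE zS xz]]]|none] := pselect (exists x z,
  [/\ lambda * y x == out_sum y x, lambda * y z < out_sum y z & edge x z]);
  last first.
  suff : lambda * y x0 == out_sum y x0 by rewrite (lt_eqF Ax0).
  apply: (@connect_invariant G (@edge G) (fun x => lambda * y x == out_sum y x)
    x1 x0 _ (Gsc x1 x0)); last by rewrite eq_le Ax1 Ay.
  move=> u v uE uv; apply/negPn/negP => vE; apply: none; exists u, v; split=> //.
  by rewrite lt_neqAle vE Ay.
pose y' w := y w + out_sum y w.
have gap w : out_sum y' w - lambda * y' w =
    (out_sum y w - lambda * y w) +
    \sum_(v | edge w v) (out_sum y v - lambda * y v).
  rewrite /y' sumrB -mulr_sumr /out_sum big_split /=; ring.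
have gap_ge0 w : 0 <= \sum_(v | edge w v) (out_sum y v - lambda * y v).
  by apply: sumr_ge0 => v _; rewrite subr_ge0.
apply: (IHk y') => [|w|w|].
- apply: leq_trans le_k; apply: proper_card; apply/properP; split.
    apply/subsetP => w; rewrite !inE eq_sym -subr_eq0 gap.
    by rewrite paddr_eq0 ?subr_ge0 // subr_eq0 eq_sym => /andP[].
  exists x; rewrite !inE //; rewrite eq_sym -subr_eq0 gap gt_eqF //.
  rewrite ltr_wpDl ?subr_ge0 // (bigD1 z) //= ltr_pwDl ?subr_gt0 //.
  by apply: sumr_ge0 => v _; rewrite subr_ge0.
- rewrite ltr_pwDl //; apply: sumr_ge0 => v _; exact: ltW.
- by rewrite -subr_ge0 gap addr_ge0 ?subr_ge0.
- exists x0; rewrite -subr_gt0 gap ltr_pwDl ?subr_gt0 //.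
Qed.

(** A positive eigenvector pulls back along an isomorphism without reference to the enumeration of
    vertices that underlies the adjacency matrix. *)
Definition perron_value lambda := exists2 y : G -> R,
  (forall x, 0 < y x) & forall x, out_sum y x = lambda * y x.

Lemma rho_perron lambda : (0 < #|G|)%N -> perron_value lambda -> rho R G = lambda.
Proof. by move=> G_gt0 [y y_gt0 Ay]; exact: rho_eq Ay. Qed.

End PerronDigraph.

(** * Digraph isomorphisms *)

Section Isomorphism.
Set Implicit Arguments.
Unset Strict Implicit.

Lemma perron_value_iso (R : realType) (G H : digraph) (lambda : R) :
  digraph_iso G H -> perron_value H lambda -> perron_value G lambda.
Proof.
move=> [f [fbij fE]] [y y_gt0 Ay]; exists (y \o f) => [x|x /=]; first exact: y_gt0.
rewrite -Ay /out_sum (reindex f) /=; last exact: onW_bij.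
by apply: eq_bigl => w; rewrite fE.
Qed.

Lemma digraph_iso_sym (G H : digraph) : digraph_iso G H -> digraph_iso H G.
Proof.
move=> [f [[g gK fK] fE]]; exists g; split; first by exists f.
by move=> x y; rewrite -fE !fK.
Qed.

(** Counting replaces two verifications: an injection between equally large vertex sets is onto, and
    so is the induced injection on edges, which means that non-edges are preserved too. *)
Lemma injective_hom_iso (G H : digraph) (f : G -> H) : injective f ->
  (forall x y, edge x y -> edge (f x) (f y)) ->
  #|G| = #|H| -> (#|edges H| <= #|edges G|)%N -> digraph_iso G H.
Proof.
move=> f_inj f_hom GH EGH; have f_bij : bijective f by apply: inj_card_bij; rewrite ?GH.
exists f; split=> // x y; apply/idP/idP => [fxy|]; last exact: f_hom.
pose F (p : G * G) := (f p.1, f p.2).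
have F_inj : injective F by move=> [a b] [c d] [/f_inj -> /f_inj ->].
have /eqP FE : F @: edges G == edges H.
  rewrite eqEcard card_imset // EGH andbT; apply/subsetP => _ /imsetP[p pE ->].
  by rewrite inE; apply: f_hom; move: pE; rewrite inE.
have : F (x, y) \in edges H by rewrite inE.
by rewrite -FE mem_imset // inE.
Qed.

End Isomorphism.

(** * Paths to the branching vertices *)

Section Descent.
Set Implicit Arguments.
Unset Strict Implicit.
Variable G : digraph.

(* Outside S every vertex x has a unique successor; following successors, x
   first meets S after [d x] steps, at [t x]. *)
Record descent (S : {set G}) (d : G -> nat) (t : G -> G) : Prop := Descent {
  descent_mem : forall x, t x \in S;
  descent_stop : forall x, x \in S -> d x = 0%N /\ t x = x;
  descent_step : forall x, x \notin S -> exists w,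
    [/\ forall v, edge x v = (v == w), d x = (d w).+1 & t x = t w]
}.

(** [d x] is the least number of iterations of the successor map that leads into [S]; outside [S]
    any walk towards [S] has to follow this map. *)
Lemma descent_exists (S : {set G}) :
  (forall x, x \notin S -> exists w, forall v, edge x v = (v == w)) ->
  (forall x, exists2 u, u \in S & connect (@edge G) x u) ->
  exists d t, descent S d t.
Proof.
move=> out1 reach; pose next (x : G) := odflt x [pick w | edge x w].
have nextE x v : x \notin S -> edge x v = (v == next x).
  move=> /out1[w xE]; rewrite xE /next; case: pickP => [w'|/(_ w)]; rewrite xE ?eqxx //.
  by move=> /eqP->.
have hit x : exists k, iter k next x \in S.
  have [u uS /connectP[p xp uE]] := reach x; move: uS; rewrite {}uE.
  elim: p x xp => [|v p IHp] x /=; first by exists 0%N.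
  move=> /andP[xv vp] /(IHp _ vp)[k kS].
  have [xS|xS] := boolP (x \in S); first by exists 0%N.
  by exists k.+1; rewrite iterSr; move: xv; rewrite nextE // => /eqP <-.
pose d x := ex_minn (hit x); exists d, (fun x => iter (d x) next x).
have d0 x : x \in S -> d x = 0%N.
  by move=> xS; apply/eqP; rewrite -leqn0 /d; case: ex_minnP => k _ /(_ 0%N); apply.
split=> [x|x xS|x xS].
- by rewrite /d; case: ex_minnP.
- by rewrite d0.
have dS : d x = (d (next x)).+1.
  apply/eqP; rewrite eqn_leq; apply/andP; split.
    rewrite {1}/d; case: ex_minnP => k _; apply; rewrite iterSr /d.
    by case: ex_minnP.
  rewrite {2}/d; case: ex_minnP => -[|k]; first by rewrite /= (negPf xS).
  rewrite iterSr => kS _; rewrite ltnS /d; case: ex_minnP => j _; exact.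
exists (next x); split=> //; first by move=> v; exact: nextE.
by rewrite dS iterSr.
Qed.

Variables (S : {set G}) (d : G -> nat) (t : G -> G).
Hypothesis dt : descent S d t.

Definition basin u : {set G} := [set x | t x == u].

Lemma descent0 x : d x = 0%N -> t x = x.
Proof.
have [/(descent_stop dt)[]//|/(descent_step dt)[w [_ -> _]] //] := boolP (x \in S).
Qed.

(** Along the path from [x] to [t x] the value of [d] drops by one at each step, so it skips no
    level. *)
Lemma descent_level x k : (k <= d x)%N -> exists y, t y = t x /\ d y = k.
Proof.
move dx: (d x) => n; elim: n => [|n IHn] in x dx *.
  by rewrite leqn0 => /eqP->; exists x.
have [xS|/(descent_step dt)[w [_ dw tw]]] := boolP (x \in S).
  by have [] := descent_stop dt xS; rewrite dx.
rewrite leq_eqVlt => /orP[/eqP->|kn]; first by exists x.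
by rewrite tw; apply: IHn => //; move: dw; rewrite dx => -[].
Qed.

(** The path from [x0] visits each of the levels [0, ..., k - 1] inside the basin, at vertices too
    low to belong to [X]. *)
Lemma basin_level_card u (X : {set G}) x0 k : X \subset basin u -> x0 \in X ->
  (forall x, x \in X -> (k <= d x)%N) -> (k + #|X| <= #|basin u|)%N.
Proof.
move=> XB x0X kX; pose L := [set y in basin u | (d y < k)%N].
have tX x : x \in X -> t x = u by move=> /(subsetP XB); rewrite inE => /eqP.
have kL : (k <= #|L|)%N.
  rewrite -(size_iota 0 k) cardE -(size_map d); apply: uniq_leq_size.
    exact: iota_uniq.
  move=> j; rewrite mem_iota add0n => /andP[_ jk].
  have [y [ty dy]] := descent_level (leq_trans (ltnW jk) (kX _ x0X)).
  by apply/mapP; exists y => //; rewrite mem_enum !inE ty dy jk tX ?eqxx.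
apply: leq_trans (leq_add kL (leqnn _)) _.
have -> : (#|L| + #|X| = #|L :|: X|)%N.
  rewrite cardsU [X in (_ - X)%N]eq_card0 ?subn0 // => y; rewrite !inE.
  apply/negP => /andP[/andP[_ yk] /kX]; rewrite leqNgt yk //.
apply: subset_leq_card; rewrite subUset XB andbT; apply/subsetP => y.
by rewrite inE => /andP[].
Qed.

(** The levels [0, ..., d s] are all occupied, which already uses up the whole basin. *)
Lemma basin_level_inj u s : t s = u -> #|basin u| = (d s).+1 ->
  {in basin u &, injective d}.
Proof.
move=> ts Bs; apply/dinjectiveP; rewrite /dinjectiveb.
apply: (leq_size_uniq (iota_uniq 0 (d s).+1)).
  move=> j; rewrite mem_iota add0n ltnS => /andP[_ js].
  have [y [ty dy]] := descent_level js.
  by apply/mapP; exists y => //; rewrite mem_enum inE ty ts.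
by rewrite size_map size_iota -cardE Bs.
Qed.

Variables (R : realType) (z : R).
Hypothesis z01 : 0 < z < 1.

Definition weight (X : {set G}) : R := \sum_(x in X) z ^+ (d x).+1.

(** Induction on the size, removing the member of [X] of least [d]. By [basin_level_card] its
    exponent is at most [#|basin u| - n], and [z < 1] turns this into a lower bound for its term.
    Equality of the sums forces equality of each exponent. *)
Lemma basin_weight u (X : {set G}) : X \subset basin u ->
  \sum_(i < #|X|) z ^+ (#|basin u| - i) <= weight X /\
  (weight X = \sum_(i < #|X|) z ^+ (#|basin u| - i) ->
   forall i, (i < #|X|)%N -> exists2 x, x \in X & ((d x).+1 + i = #|basin u|)%N).
Proof.
have /andP[z_gt0 z_lt1] := z01.
move Xn: #|X| => n; elim: n => [|n IHn] in X Xn *.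
  move: Xn => /cards0_eq -> _; rewrite /weight big_set0 big_ord0; split=> //.
move=> XB; have /card_gt0P[x1 x1X] : (0 < #|X|)%N by rewrite Xn.
case: (arg_minnP d x1X) => x0 x0in dmin.
have x0X : x0 \in X by [].
have Xx0 : #|X :\ x0| = n by rewrite (cardsD1 x0) x0X in Xn; case: Xn.
have [IHle IHeq] := IHn _ Xx0 (subset_trans (subsetDl _ _) XB).
have := basin_level_card XB x0X dmin; rewrite Xn => dX.
have -> : weight X = z ^+ (d x0).+1 + weight (X :\ x0).
  by rewrite /weight (big_setD1 x0).
have zle : z ^+ (#|basin u| - n) <= z ^+ (d x0).+1.
  apply: ler_wiXn2l; [exact: ltW|exact: ltW|lia].
rewrite big_ord_recr /= addrC lerD //; split=> // eqw i.
rewrite ltnS leq_eqVlt => /orP[/eqP->|i_n].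
  exists x0 => //; have : z ^+ (#|basin u| - n) == z ^+ (d x0).+1 by apply/eqP; lra.
  by move=> /eqP/(ieexprIn z_gt0 (negbT (lt_eqF z_lt1))); lia.
have [x] := IHeq ltac:(lra) i i_n.
by rewrite inE => /andP[_ xX] xi; exists x.
Qed.

End Descent.

(** * Distribution of the out-degrees *)

Section OutDegree.
Set Implicit Arguments.
Unset Strict Implicit.
Variable G : digraph.

Definition out (x : G) : {set G} := [set w | edge x w].

Lemma card_edges : #|edges G| = (\sum_x #|out x|)%N.
Proof.
rewrite -sum1_card (eq_bigl (fun p : G * G => true && edge p.1 p.2)); last first.
  by move=> p; rewrite inE.
rewrite -(pair_big_dep predT (fun x w => edge x w) (fun _ _ => 1%N)) /=.
by apply: eq_bigr => x _; rewrite sum1_card cardsE.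
Qed.

Lemma out_gt0 x : strongly_connected G -> (1 < #|G|)%N -> (0 < #|out x|)%N.
Proof.
move=> Gsc /card_gt1P[y0 [y1 [_ _ y01]]].
have [y yx] : exists y, y != x.
  by have [y0x|] := eqVneq y0 x; [exists y1; rewrite -y0x eq_sym | exists y0].
have /connectP[[|w p] /= xp yE] := Gsc x y.
  by rewrite yE eqxx in yx.
by apply/card_gt0P; exists w; rewrite inE; case/andP: xp.
Qed.

Lemma out_degrees : strongly_connected G -> (1 < #|G|)%N ->
  #|edges G| = (#|G| + 2)%N ->
  (exists u, #|out u| = 3 /\ forall x, x != u -> #|out x| = 1%N) \/
  (exists u v, [/\ u != v, #|out u| = 2, #|out v| = 2 &
     forall x, x != u -> x != v -> #|out x| = 1%N]).
Proof.
move=> Gsc G_gt1; rewrite card_edges.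
rewrite (eq_bigr (fun x => 1 + #|out x|.-1)%N); last first.
  by move=> x _; have := out_gt0 x Gsc G_gt1; lia.
rewrite big_split /= sum1_card => /addnI sum2.
have [u u_gt0] : exists u, (0 < #|out u|.-1)%N.
  apply: contrapT => none; move: sum2; rewrite big1 // => x _.
  by apply/eqP; rewrite -leqn0 leqNgt; apply/negP => x_gt0; apply: none; exists x.
rewrite (bigD1 u) //= in sum2.
have [u2|u1] := eqVneq #|out u|.-1 2%N.
  left; exists u; split=> [|x xu]; first by lia.
  have := out_gt0 x Gsc G_gt1; rewrite (bigD1 x) //= in sum2; lia.
have [v] : exists v, (v != u) && (0 < #|out v|.-1)%N.
  apply: contrapT => none; move: sum2; rewrite big1 ?addn0; first by lia.
  move=> x xu; apply/eqP; rewrite -leqn0 leqNgt; apply/negP => x_gt0.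
  by apply: none; exists x; rewrite xu.
case/andP=> vu v_gt0; rewrite (bigD1 v) //= in sum2.
right; exists u, v; split; [by rewrite eq_sym|lia|lia|].
move=> x xu xv; have := out_gt0 x Gsc G_gt1.
by rewrite (bigD1 x) ?xu //= in sum2; lia.
Qed.

Lemma out_card1 x : #|out x| = 1%N -> exists w, forall v, edge x v = (v == w).
Proof.
move=> /eqP/cards1P[w xE]; exists w => v.
by have := in_set1 v w; rewrite -xE inE.
Qed.

End OutDegree.

(** * Positive test functions built from their values on the branching vertices *)

Section Potential.
Set Implicit Arguments.
Unset Strict Implicit.
Variables (R : realType) (z : R) (G : digraph) (S : {set G}) (d : G -> nat) (t : G -> G).
Hypotheses (z_gt0 : 0 < z) (dt : descent S d t).

(* Extends c from S to all vertices so that the eigenvalue equation for 1/z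
   holds exactly outside S. *)
Definition potential (c : G -> R) (x : G) : R := z ^+ d x * c (t x).

Lemma potential_out_sum c x :
  z * out_sum (potential c) x = \sum_(w in out x) z ^+ (d w).+1 * c (t w).
Proof.
rewrite /out_sum mulr_sumr; apply: eq_big => w; rewrite ?inE // => _.
by rewrite /potential exprS mulrA.
Qed.

Lemma potential_notin c x : x \notin S ->
  z * out_sum (potential c) x = potential c x.
Proof.
move=> xS; rewrite potential_out_sum.
have [w [xE dx tx]] := descent_step dt xS.
rewrite (eq_bigl (pred1 w)) ?big_pred1_eq ?/potential ?dx ?tx // => v.
by rewrite inE xE.
Qed.

Lemma potential_in c x : x \in S -> potential c x = c x.
Proof.
by move=> xS; rewrite /potential; have [-> ->] := descent_stop dt xS; rewrite mul1r.
Qed.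

Lemma potential_subinvariant c : (forall u, u \in S -> 0 < c u) ->
  (forall u, u \in S -> c u <= \sum_(w in out u) z ^+ (d w).+1 * c (t w)) ->
  exists y : G -> R, [/\ forall x, 0 < y x,
    forall x, z^-1 * y x <= out_sum y x &
    (exists2 u, u \in S & c u < \sum_(w in out u) z ^+ (d w).+1 * c (t w)) ->
     exists x, z^-1 * y x < out_sum y x].
Proof.
move=> c_gt0 cS; exists (potential c); split=> [x|x|[u uS cu]].
- by rewrite mulr_gt0 ?exprn_gt0 ?c_gt0 // (descent_mem dt).
- rewrite ler_pdivrMl //; have [xS|xS] := boolP (x \in S); last first.
    by rewrite potential_notin.
  by rewrite potential_in // potential_out_sum cS.
- by exists u; rewrite ltr_pdivrMl // potential_in // potential_out_sum.
Qed.

End Potential.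

(** * Inequalities between powers of the root *)

Section MinimalRoot.
Set Implicit Arguments.
Unset Strict Implicit.
Variables (R : realType) (m : nat) (z : R).
Hypotheses (m_ge3 : (3 <= m)%N) (z01 : 0 < z < 1).
Hypothesis zm : z ^+ m + 2 * z ^+ m.-1 = 1.

(** The left-over after subtracting the equation for [z] is [z^(m-2) - z^(m-1) > 0]. *)
Lemma root_consecutive_powers : 1 < z ^+ m + z ^+ m.-1 + z ^+ (m - 2).
Proof.
have /andP[z_gt0 z_lt1] := z01; have := exprn_gt0 (m - 2) z_gt0.
have -> : m.-1 = (m - 2).+1 by lia.
move: zm; have -> : m.-1 = (m - 2).+1 by lia.
rewrite exprS; nra.
Qed.

(** The equation gives [z^m = z / (z + 2)], which exceeds [1/4] once [z > 2/3]. As [z^p z^q = z^m],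
    the arithmetic-geometric mean inequality yields a sum above 1. *)
Lemma root_two_powers p q : (4 <= m)%N -> (p + q)%N = m -> 1 < z ^+ p + z ^+ q.
Proof.
move=> m4 pqm; have /andP[z_gt0 z_lt1] := z01.
(* If [z <= 2/3] and [m >= 4], then [z^m + 2 z^(m-1) <= 16/81 + 16/27 = 64/81 < 1]. *)
have z23 : 2 / 3 < z.
  rewrite ltNge; apply/negP => z_le.
  have h4 : z ^+ m <= z ^+ 4 by apply: ler_wiXn2l; rewrite ?ltW.
  have h3 : z ^+ m.-1 <= z ^+ 3 by apply: ler_wiXn2l; rewrite ?ltW //; lia.
  have k2 : z ^+ 2 <= 4 / 9 by rewrite expr2; nra.
  have k3 : z ^+ 3 <= 8 / 27 by rewrite exprS; nra.
  have k4 : z ^+ 4 <= 16 / 81 by rewrite exprS; nra.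
  move: zm h4 h3; lra.
have wz : z ^+ m = z * z ^+ m.-1 by rewrite -exprS; congr (_ ^+ _); lia.
have : z ^+ m = z ^+ p * z ^+ q by rewrite -exprD pqm.
have := exprn_gt0 p z_gt0; have := exprn_gt0 q z_gt0.
have := exprn_gt0 m.-1 z_gt0.
move: (z ^+ p) (z ^+ q) (z ^+ m.-1) (z ^+ m) wz zm => a b c e wz zm' c0 b0 a0 eab.
have e14 : 1 / 4 < e by rewrite wz; nra.
have := sqr_ge0 (a - b); rewrite expr2; nra.
Qed.

Lemma root_three : m = 3%N -> z + z ^+ 2 = 1.
Proof.
move=> m3; move: zm z01; rewrite m3 /= exprS expr2 => h /andP[z0 z1].
(* For [m = 3] the polynomial [z^3 + 2 z^2 - 1] has the factor [z + 1]. *)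
have : (z + 1) * (z + z * z - 1) = 0 by move: h; lra.
by move=> /eqP; rewrite mulf_eq0 => /orP[]/eqP; lra.
Qed.

End MinimalRoot.

(** * Presentations and isomorphisms *)

Section Presentations.
Set Implicit Arguments.
Unset Strict Implicit.

Lemma card_digraph_of (L : choiceType) (P : presentation L) :
  uniq (labels P) -> #|digraph_of P| = size (labels P).
Proof. exact: card_seq_sub. Qed.

Lemma card_edges_le (L : choiceType) (P : presentation L) :
  (#|edges (digraph_of P)| <= size (arcs P))%N.
Proof.
pose F (p : digraph_of P * digraph_of P) := (val p.1, val p.2).
rewrite cardE -(size_map F); apply: uniq_leq_size.
  by rewrite map_inj_uniq ?enum_uniq // => -[a b] [c e] [/val_inj -> /val_inj ->].
by move=> _ /mapP[p + ->]; rewrite mem_enum inE.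
Qed.

Lemma card_edges_ge (L : choiceType) (P : presentation L) : uniq (arcs P) ->
  (forall a, a \in arcs P -> a.1 \in labels P /\ a.2 \in labels P) ->
  (size (arcs P) <= #|edges (digraph_of P)|)%N.
Proof.
move=> Puniq PL; pose F (p : digraph_of P * digraph_of P) := (val p.1, val p.2).
rewrite cardE -(size_map F); apply: uniq_leq_size => // -[a b] ab.
have [/= aL bL] := PL _ ab; apply/mapP.
by exists (SeqSub aL, SeqSub bL); rewrite // mem_enum inE.
Qed.

Lemma digraph_iso_labelling (L : choiceType) (P : presentation L) (G : digraph)
    (f : G -> L) : injective f -> (forall x, f x \in labels P) ->
  (forall x y, edge x y -> (f x, f y) \in arcs P) ->
  #|G| = #|digraph_of P| -> (#|edges (digraph_of P)| <= #|edges G|)%N ->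
  digraph_iso G (digraph_of P).
Proof.
move=> f_inj fL f_hom; apply: (@injective_hom_iso _ (digraph_of P)
  (fun x => SeqSub (fL x) : digraph_of P)) => [x y /(congr1 val)/f_inj //|x y xy].
exact: f_hom.
Qed.

Lemma digraph_iso_relabel (L L' : choiceType) (P : presentation L)
    (Q : presentation L') (f : L -> L') : {in labels P &, injective f} ->
  map f (labels P) =i labels Q ->
  (forall a, a \in arcs P -> a.1 \in labels P /\ a.2 \in labels P) ->
  [seq (f a.1, f a.2) | a <- arcs P] =i arcs Q ->
  digraph_iso (digraph_of Q) (digraph_of P).
Proof.
move=> f_inj fL PL fA; apply: digraph_iso_sym.
have fQ (x : digraph_of P) : f (val x) \in labels Q.
  by rewrite -fL; apply: map_f; exact: valP.
pose F (x : digraph_of P) : digraph_of Q := SeqSub (fQ x).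
have F_inj : injective F.
  move=> x y /(congr1 val) /= /f_inj; rewrite !(valP x) !(valP y) => /(_ isT isT).
  exact: val_inj.
exists F; split.
  have Fsurj (y : digraph_of Q) : exists x, F x == y.
    have : val y \in map f (labels P) by rewrite fL; exact: valP.
    by move=> /mapP[l lP yl]; exists (SeqSub lP); rewrite -val_eqE /= yl.
  exists (fun y => xchoose (Fsurj y)) => [x|y].
    by apply: F_inj; exact: (eqP (xchooseP (Fsurj _))).
  exact: (eqP (xchooseP (Fsurj _))).
move=> x y; rewrite /= -fA; apply/mapP/idP => [[a aP [fx fy]]|xy]; last first.
  by exists (val x, val y).
have [a1 a2] := PL _ aP.
have xa : val x = a.1 by apply: f_inj => //; exact: valP.
have ya : val y = a.2 by apply: f_inj => //; exact: valP.
by rewrite -[ssval x]/(val x) -[ssval y]/(val y) xa ya -surjective_pairing.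
Qed.

Lemma steps_cons2 (L : Type) (x y : L) s : steps (x :: y :: s) = (x, y) :: steps (y :: s).
Proof. by []. Qed.

Lemma steps_rcons2 (L : Type) (s : seq L) x y :
  steps (rcons (rcons s x) y) = rcons (steps (rcons s x)) (x, y).
Proof.
elim: s => // a s; case: s => // b s IHs.
by rewrite !rcons_cons steps_cons2 -!rcons_cons IHs !rcons_cons.
Qed.

Lemma map_steps (L L' : Type) (f : L -> L') s :
  steps (map f s) = [seq (f a.1, f a.2) | a <- steps s].
Proof. by elim: s => // x [//|y s] IHs; rewrite steps_cons2 /= -IHs. Qed.

Lemma mem_steps_iota k n a b :
  ((a, b) \in steps (iota k n.+1)) = [&& k <= a, a < k + n & b == a.+1]%N.
Proof.
elim: n k => [|n IHn] k.
  by rewrite /steps /= in_nil; apply/esym/negbTE; lia.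
rewrite [iota k n.+2]/= steps_cons2 -[k.+1 :: _]/(iota k.+1 n.+1) in_cons IHn xpair_eqE.
lia.
Qed.

Lemma mem_steps_iota_rcons k n c a b : (0 < n)%N ->
  ((a, b) \in steps (rcons (iota k n) c)) =
    [&& k <= a, a.+1 < k + n & b == a.+1]%N || (a.+1 == k + n)%N && (b == c).
Proof.
case: n => // n _.
have -> : iota k n.+1 = rcons (iota k n) (k + n) by rewrite -addn1 iotaD cats1.
rewrite steps_rcons2 mem_rcons in_cons xpair_eqE.
have -> : rcons (iota k n) (k + n) = iota k n.+1 by rewrite -[in RHS]addn1 iotaD cats1.
by rewrite mem_steps_iota; lia.
Qed.

End Presentations.

(** * The cross-chorded cycle: its size, connectedness and Perron vector *)

Section CrossChorded.
Set Implicit Arguments.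
Unset Strict Implicit.
Variable m : nat.
Hypothesis m_ge3 : (3 <= m)%N.

Definition cross_arcs : seq (nat * nat) := [seq (k, k.+1) | k <- iota 1 m.-1] ++
     [:: (m, 1%N); (cyc m 1, cyc m 3); (cyc m 2, cyc m 4)].

(** Only for [m = 3] does an index wrap around: there the chord from [v_2] ends at [v_1]. *)
Lemma cyc4 : cyc m 4 = if (4 <= m)%N then 4%N else 1%N.
Proof.
rewrite /cyc /=; case: ltnP => m4; first by rewrite modn_small.
have -> : m = 3%N by lia.
by [].
Qed.

Lemma mem_cross_arcs a b : ((a, b) \in cross_arcs) =
  [|| [&& 1 <= a, a < m & b == a.+1]%N, (a == m) && (b == 1)%N,
    (a == 1)%N && (b == 3)%N | (a == 2)%N && (b == if (4 <= m) then 4 else 1)%N].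
Proof.
rewrite /cross_arcs mem_cat !in_cons in_nil orbF !xpair_eqE cyc4.
have -> : cyc m 1 = 1%N by rewrite /cyc /= mod0n.
have -> : cyc m 2 = 2%N by rewrite /cyc /= modn_small //; lia.
have -> : cyc m 3 = 3%N by rewrite /cyc /= modn_small //; lia.
congr (_ || _); apply/mapP/idP => [[k]|/and3P[a1 am /eqP->]].
  by rewrite mem_iota => km [-> ->]; rewrite eqxx; lia.
by exists a; rewrite // mem_iota; lia.
Qed.

Lemma cross_arcs_labels a : a \in cross_arcs -> a.1 \in iota 1 m /\ a.2 \in iota 1 m.
Proof.
case: a => a b; rewrite mem_cross_arcs !mem_iota /=; case: ifP; lia.
Qed.

Lemma card_cross_chorded : #|cross_chorded m| = m.
Proof. by rewrite card_digraph_of ?size_iota ?iota_uniq. Qed.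

Lemma card_edges_cross_chorded : #|edges (cross_chorded m)| = (m + 2)%N.
Proof.
have sz : size cross_arcs = (m + 2)%N.
  by rewrite /cross_arcs size_cat size_map size_iota /=; lia.
apply/eqP; rewrite -sz eqn_leq.
rewrite (@card_edges_le _ (Presentation (iota 1 m) cross_arcs)) /=.
apply: (@card_edges_ge _ (Presentation (iota 1 m) cross_arcs)) cross_arcs_labels.
rewrite /= /cross_arcs cat_uniq map_inj_uniq ?iota_uniq; last by move=> x y [].
rewrite /= !in_cons !in_nil !xpair_eqE !orbF cyc4.
have -> : cyc m 1 = 1%N by rewrite /cyc /= mod0n.
have -> : cyc m 2 = 2%N by rewrite /cyc /= modn_small //; lia.
have -> : cyc m 3 = 3%N by rewrite /cyc /= modn_small //; lia.
have memE a b : ((a, b) \in [seq (k, k.+1) | k <- iota 1 m.-1]) =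
    [&& 1 <= a, a < m & b == a.+1]%N.
  apply/mapP/idP => [[k]|/and3P[a1 am /eqP->]].
    by rewrite mem_iota => km [-> ->]; rewrite eqxx; lia.
  by exists a; rewrite // mem_iota; lia.
rewrite !memE; case: ifP; lia.
Qed.

End CrossChorded.

Section OutSums.
Set Implicit Arguments.
Unset Strict Implicit.
Variables (R : realType) (G : digraph) (y : G -> R) (x : G).

Lemma out_sum1 a : (forall w, edge x w = (w == a)) -> out_sum y x = y a.
Proof. by move=> xE; rewrite /out_sum (big_pred1 a). Qed.

Lemma out_sum2 a b : a != b -> (forall w, edge x w = (w == a) || (w == b)) ->
  out_sum y x = y a + y b.
Proof.
move=> ab xE; rewrite /out_sum (bigD1 a) ?xE ?eqxx //=; congr (_ + _).
apply: big_pred1 => w; rewrite /= xE.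
by case: eqVneq => [->|_]; rewrite ?(negPf ab) ?andbT ?andbF.
Qed.

End OutSums.

Section CrossChordedPerron.
Set Implicit Arguments.
Unset Strict Implicit.
Variable m : nat.
Lemma cross_vertexP k : (0 < k <= m)%N -> k \in iota 1 m.
Proof. by rewrite mem_iota; lia. Qed.

Definition cross_vertex k (hk : (0 < k <= m)%N) : cross_chorded m :=
  SeqSub (cross_vertexP hk).

Definition cross_label (x : cross_chorded m) : nat := ssval x.

Lemma cross_edgeE (x w : cross_chorded m) :
  edge x w = ((cross_label x, cross_label w) \in cross_arcs m).
Proof. by []. Qed.

Lemma cross_val (x : cross_chorded m) : (0 < cross_label x <= m)%N.
Proof. by have := valP x; rewrite mem_iota -[\val x]/(cross_label x); lia. Qed.

Hypothesis m_ge3 : (3 <= m)%N.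

Lemma cross_chorded_connected : strongly_connected (cross_chorded m).
Proof.
have up n (x y : cross_chorded m) : cross_label y = (cross_label x + n)%N ->
    connect (@edge _) x y.
  elim: n x => [|n IHn] x yx.
    have -> : y = x by apply: val_inj; rewrite -[val y]/(cross_label y) yx addn0.
    exact: connect0.
  have hx1 : (0 < (cross_label x).+1 <= m)%N by have := cross_val y; lia.
  apply: (@connect_trans _ _ (cross_vertex hx1)).
    apply: connect1; rewrite cross_edgeE mem_cross_arcs // eqxx /=.
    by have := cross_val x; lia.
  by apply: IHn; rewrite /= yx; lia.
move=> x y; have h1 : (0 < 1 <= m)%N by lia.
have hm : (0 < m <= m)%N by lia.
apply: (@connect_trans _ _ (cross_vertex hm)).
  by apply: (up (m - cross_label x)%N); have := cross_val x; rewrite /=; lia.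
apply: (@connect_trans _ _ (cross_vertex h1)).
  by apply: connect1; rewrite cross_edgeE mem_cross_arcs //= !eqxx orbT.
by apply: (up (cross_label y).-1); have := cross_val y; rewrite /=; lia.
Qed.

Lemma cross_chorded_SC : SC (m + 2) m (cross_chorded m).
Proof.
by split; [exact: card_cross_chorded|exact: card_edges_cross_chorded|
  exact: cross_chorded_connected].
Qed.

Lemma cross_chorded_perron (R : realType) (z : R) : 0 < z ->
  z ^+ m + 2 * z ^+ m.-1 = 1 -> perron_value (cross_chorded m) z^-1.
Proof.
move=> z_gt0 zm.
(* With value 1 at [v_1], each [v_k] with [k >= 3] gets [z] to the length of its path to [v_1], and
   [v_2] gets [z] times the values at [v_3] and [v_4]. The equation left at [v_1] is
   [z^m + 2 z^(m-1) = 1]. *)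
pose g k : R := if (k == 1)%N then 1 else
  if (k == 2)%N then z ^+ m.-1 + z ^+ (m - 2) else z ^+ (m.+1 - k).
exists (fun x => g (cross_label x)) => [x|x].
  rewrite /g; case: ifP => // _; case: ifP => _; rewrite ?exprn_gt0 //.
  by rewrite addr_gt0 ?exprn_gt0.
suff : z * out_sum (fun x => g (cross_label x)) x = g (cross_label x).
  by move=> <-; rewrite mulKf // gt_eqF.
have [h1 h2 h3] : [/\ 0 < 1 <= m, 0 < 2 <= m & 0 < 3 <= m]%N by split; lia.
have vE (w : cross_chorded m) k (hk : (0 < k <= m)%N) :
    (w == cross_vertex hk) = (cross_label w == k).
  by rewrite -val_eqE.
have hx := cross_val x.
have [x1|x1] := eqVneq (cross_label x) 1%N.
  rewrite (@out_sum2 _ _ _ _ (cross_vertex h2) (cross_vertex h3)) //; last first.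
    by move=> w; rewrite cross_edgeE mem_cross_arcs // !vE x1; lia.
  rewrite x1 /g /= -zm mulrDr mulrDr -!exprS.
  have -> : (m - 2).+1 = m.-1 by lia.
  have -> : m.-1.+1 = m by lia.
  ring.
have [x2|x2] := eqVneq (cross_label x) 2%N.
  have h4 : (0 < (if 4 <= m then 4 else 1) <= m)%N by case: ifP; lia.
  rewrite (@out_sum2 _ _ _ _ (cross_vertex h3) (cross_vertex h4)) //; first last.
  - by move=> w; rewrite cross_edgeE mem_cross_arcs // !vE x2; lia.
  - by rewrite vE /=; case: ifP.
  rewrite x2 /= /g /=; have [m4|m4] := leqP 4 m => /=.
    rewrite mulrDr -!exprS; congr (_ ^+ _ + _ ^+ _); lia.
  have -> : m = 3%N by lia.
  by rewrite /= expr1 mulrDr mulr1 -expr2.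
have [xm|xm] := eqVneq (cross_label x) m.
  rewrite (@out_sum1 _ _ _ _ (cross_vertex h1)); last first.
    move=> w; rewrite cross_edgeE mem_cross_arcs // vE xm; case: ifP; lia.
  rewrite /g /= xm; have -> : (m == 1)%N = false by lia.
  have -> : (m == 2)%N = false by lia.
  by rewrite mulr1 subSn // subnn expr1.
have hx1 : (0 < (cross_label x).+1 <= m)%N by lia.
rewrite (@out_sum1 _ _ _ _ (cross_vertex hx1)); last first.
  by move=> w; rewrite cross_edgeE mem_cross_arcs // vE; case: ifP; lia.
rewrite /g /=.
have -> : ((cross_label x).+1 == 1)%N = false by lia.
have -> : ((cross_label x).+1 == 2)%N = false by lia.
rewrite (negPf x1) (negPf x2) -exprS; congr (_ ^+ _); lia.
Qed.

End CrossChordedPerron.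

(** * The second extremal digraph on three vertices *)

Section ThreeVertices.
Set Implicit Arguments.
Unset Strict Implicit.

Local Notation D3 := (eared_butterfly W1 2 W1 3 0 3 1 1).
Local Notation D3_presentation :=
  (insert_ear 0 (W1, 2) (W1, 3) (butterfly 3 1 1)).

Lemma card_D3 : #|D3| = 3%N.
Proof. by rewrite card_digraph_of. Qed.

Lemma card_edges_D3 : (#|edges D3| <= 5)%N.
Proof. exact: card_edges_le. Qed.

(** The second cycle of the butterfly is a loop at [h_1], whereas the cross-chorded cycle has no
    loop. *)
Lemma D3_not_cross_chorded : ~ digraph_iso D3 (cross_chorded 3).
Proof.
move=> [f [_ fE]]; have hL : inl (Head, 1%N) \in labels D3_presentation by [].
have := fE (SeqSub hL) (SeqSub hL); rewrite cross_edgeE mem_cross_arcs //.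
have -> : edge (SeqSub hL : D3) (SeqSub hL) = true by [].
by rewrite /=; lia.
Qed.

Lemma D3_perron (R : realType) (z : R) : 0 < z -> z + z ^+ 2 = 1 ->
  perron_value D3 z^-1.
Proof.
move=> z_gt0 z2.
(* Both [h_1] and [w_2] have the successors [w_3] and [h_1], giving [z (z + 1) = 1]; the only
   successor of [w_3] is [w_2]. *)
pose g (l : butterfly_label + nat) : R := if l == inl (W1, 3%N) then z else 1.
exists (fun x : D3 => g (val x)) => [x|x].
  by rewrite /g; case: ifP.
suff : z * out_sum (fun x : D3 => g (val x)) x = g (val x).
  by move=> <-; rewrite mulKf // gt_eqF.
have hh : inl hd1 \in labels D3_presentation by [].
have h3 : inl (W1, 3%N) \in labels D3_presentation by [].
have h2 : inl (W1, 2%N) \in labels D3_presentation by [].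
have cases (w : D3) : [|| w == SeqSub hh, w == SeqSub h3 | w == SeqSub h2].
  by have := valP w; rewrite -!val_eqE /= !in_cons in_nil orbF.
have : [|| x == SeqSub hh, x == SeqSub h3 | x == SeqSub h2] by exact: cases.
case/or3P => /eqP->.
- rewrite (@out_sum2 _ D3 _ _ (SeqSub h3) (SeqSub hh)) // => [|w]; last first.
    by case/or3P: (cases w) => /eqP ->.
  by rewrite /g /= mulrDr mulr1 -expr2 addrC.
- rewrite (@out_sum1 _ D3 _ _ (SeqSub h2)) // => [|w]; last first.
    by case/or3P: (cases w) => /eqP ->.
  by rewrite /g /= mulr1.
- rewrite (@out_sum2 _ D3 _ _ (SeqSub h3) (SeqSub hh)) // => [|w]; last first.
    by case/or3P: (cases w) => /eqP ->.
  by rewrite /g /= mulrDr mulr1 -expr2 addrC.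
Qed.

End ThreeVertices.

(** * Eared butterflies isomorphic to the cross-chorded cycle *)

Section EaredButterflies.
Set Implicit Arguments.
Unset Strict Implicit.

(** Body indices decrease along the cycle while the [v_k] increase; this rewrites the former as the
    image of an ascending range starting at any chosen [b]. *)
Lemma rev_iota_map a b n :
  rev (iota a n) = [seq ((a + n + b).-1 - k)%N | k <- iota b n].
Proof.
apply: (@eq_from_nth _ 0%N) => [|i]; rewrite size_rev ?size_map ?size_iota // => i_n.
rewrite nth_rev ?size_iota // nth_iota; last by lia.
by rewrite (nth_map 0%N) ?size_iota // nth_iota //; lia.
Qed.

Lemma insert_ear0 (L : Type) (u v : L) (P : presentation L) :
  insert_ear 0 u v P = Presentation (map inl (labels P))
    (rcons [seq (inl a.1, inl a.2) | a <- arcs P] (inl u, inl v)).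
Proof. by rewrite /insert_ear /= cats0 cats1. Qed.

Lemma mem_steps_cons_iota_rcons x k n c a b : (0 < n)%N ->
  ((a, b) \in steps (x :: rcons (iota k n) c)) =
    [|| (a == x) && (b == k), [&& k <= a, a.+1 < k + n & b == a.+1]%N |
      (a.+1 == k + n)%N && (b == c)].
Proof.
move=> n_gt0; rewrite -(mem_steps_iota_rcons _ _ _ _ n_gt0).
by case: n n_gt0 => // n _; rewrite /= steps_cons2 in_cons xpair_eqE.
Qed.

Lemma mem_cycle_arcs_iota x k n a b : (0 < n)%N ->
  ((a, b) \in cycle_arcs x (iota k n)) =
    [|| (a == x) && (b == k), [&& k <= a, a.+1 < k + n & b == a.+1]%N |
      (a.+1 == k + n)%N && (b == x)].
Proof. exact: mem_steps_cons_iota_rcons. Qed.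

Lemma mem_cycle_arcs_cons_iota x y k n a b : (0 < n)%N ->
  ((a, b) \in cycle_arcs x (y :: iota k n)) =
    [|| (a == x) && (b == y), (a == y) && (b == k),
      [&& k <= a, a.+1 < k + n & b == a.+1]%N | (a.+1 == k + n)%N && (b == x)].
Proof.
move=> n_gt0; rewrite /cycle_arcs rcons_cons steps_cons2 in_cons xpair_eqE.
by rewrite mem_steps_cons_iota_rcons.
Qed.

Lemma mem_cycle_arcs_iota_rcons x y k n a b : (0 < n)%N ->
  ((a, b) \in cycle_arcs x (rcons (iota k n) y)) =
    [|| (a == y) && (b == x), (a == x) && (b == k),
      [&& k <= a, a.+1 < k + n & b == a.+1]%N | (a.+1 == k + n)%N && (b == y)].
Proof.
move=> n_gt0; rewrite /cycle_arcs -!rcons_cons steps_rcons2 mem_rcons in_cons.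
by rewrite xpair_eqE rcons_cons mem_steps_cons_iota_rcons.
Qed.

Variable m : nat.
Hypothesis m_ge4 : (4 <= m)%N.
Let m_ge3 : (3 <= m)%N. Proof. by lia. Qed.

(* Relabels C_m^x as an eared butterfly, given the two cycles of the latter
   as images of cycles of natural numbers. *)
Lemma eared_butterfly_iso (f : nat -> butterfly_label) (X Y : region)
    (i j k1 k2 t h a b : nat) (p1 p2 : seq nat) :
  {in iota 1 m &, injective f} ->
  f h = hd1 -> f a = (X, i) -> f b = (Y, j) ->
  wing false k1 t ++ body t = map f p1 ->
  wing true k2 t ++ body t = map f p2 ->
  h :: p1 ++ p2 =i iota 1 m ->
  rcons (cycle_arcs h p1 ++ cycle_arcs h p2) (a, b) =i cross_arcs m ->
  digraph_iso (eared_butterfly X i Y j 0 k1 k2 t) (cross_chorded m).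
Proof.
move=> f_inj fh fa fb f1 f2 labE arcE.
rewrite /eared_butterfly insert_ear0.
apply: (@digraph_iso_relabel _ _ (Presentation (iota 1 m) (cross_arcs m)) _ (inl \o f)).
- by move=> x y xm ym [/f_inj]; apply.
- move=> l /=; rewrite map_comp.
  have lE : map f (iota 1 m) =i hd1 :: wing false k1 t ++ wing true k2 t ++ body t.
    move=> l'; rewrite -(eq_mem_map f labE) map_cons map_cat fh -f1 -f2.
    rewrite !in_cons !mem_cat; do !case: (_ \in _) => //.
  by rewrite (eq_mem_map _ lE) map_cons !map_cat.
- exact: cross_arcs_labels.
- move=> e /=.
  have cycE p : cycle_arcs (f h) (map f p) = [seq (f c.1, f c.2) | c <- cycle_arcs h p].
    by rewrite /cycle_arcs -map_rcons -map_cons map_steps.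
  rewrite f1 f2 -fh !cycE -map_cat -fa -fb.
  rewrite -map_comp -(map_rcons (fun c => (inl (f c.1), inl (f c.2))) _ (a, b)).
  by rewrite (eq_mem_map _ arcE).
Qed.

Lemma eared_butterfly_iso1 :
  digraph_iso (eared_butterfly W1 m Body (m - 2) 0 m (m - 1) (m - 1))
    (cross_chorded m).
Proof.
(* The two cycles are [v_1 v_2 v_3 ... v_m] and [v_1 v_3 ... v_m]; the ear is the chord from [v_2]
   to [v_4]. *)
pose f k : butterfly_label :=
  if k == 1%N then hd1 else if k == 2%N then (W1, m) else (Body, (m + 2 - k)%N).
have bodyE : body (m - 1) = map f (iota 3 (m - 2)).
  rewrite /body (rev_iota_map _ 3) -map_comp.
  have -> : (m - 1).-1 = (m - 2)%N by lia.
  apply/eq_in_map => k; rewrite mem_iota => hk; rewrite /f /=.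
  have -> : (k == 1)%N = false by lia.
  have -> : (k == 2)%N = false by lia.
  congr (_, _); lia.
apply: (@eared_butterfly_iso f _ _ _ _ _ _ _ 1 2 4
  (2 :: iota 3 (m - 2)) (iota 3 (m - 2))) => //.
- move=> x y; rewrite !mem_iota /f /hd1 => hx hy.
  by do !case: ifP => ?; first [lia | move=> [] *; lia].
- by rewrite /f /=; congr (_, _); lia.
- rewrite /wing bodyE; have -> : (m - (m - 1) = 1)%N by lia.
  by rewrite /= /f /=; congr ((_, _) :: _); lia.
- rewrite /wing bodyE; have -> : (m - 1 - (m - 1) = 0)%N by lia.
  by [].
- move=> x; rewrite !in_cons mem_cat !mem_iota; lia.
- case=> x y; rewrite mem_cross_arcs // mem_rcons in_cons mem_cat.
  rewrite (@mem_cycle_arcs_cons_iota 1 2 3) ?(@mem_cycle_arcs_iota 1 3); try lia.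
  rewrite xpair_eqE m_ge4; case: (ltngtP x 1%N) => [?|?|->]; [lia| |lia].
  case: (ltngtP x 2) => [?|?|->]; [lia| |lia].
  by case: (ltngtP x 3) => [?|?|->]; lia.
Qed.

Lemma eared_butterfly_iso2 :
  digraph_iso (eared_butterfly W1 (m - 1) W2 (m - 1) 0 (m - 1) (m - 1) (m - 2))
    (cross_chorded m).
Proof.
(* The two cycles are [v_1 v_2 v_4 ... v_m] and [v_1 v_3 v_4 ... v_m]; the ear is the edge from
   [v_2] to [v_3]. *)
pose f k : butterfly_label :=
  if k == 1%N then hd1 else if k == 2%N then (W1, (m - 1)%N)
  else if k == 3%N then (W2, (m - 1)%N) else (Body, (m + 2 - k)%N).
have bodyE : body (m - 2) = map f (iota 4 (m - 3)).
  rewrite /body (rev_iota_map _ 4) -map_comp.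
  have -> : (m - 2).-1 = (m - 3)%N by lia.
  apply/eq_in_map => k; rewrite mem_iota => hk; rewrite /f /=.
  have -> : (k == 1)%N = false by lia.
  have -> : (k == 2)%N = false by lia.
  have -> : (k == 3)%N = false by lia.
  congr (_, _); lia.
apply: (@eared_butterfly_iso f _ _ _ _ _ _ _ 1 2 3
  (2 :: iota 4 (m - 3)) (3 :: iota 4 (m - 3))) => //.
- move=> x y; rewrite !mem_iota /f /hd1 => hx hy.
  by do !case: ifP => ?; first [lia | move=> [] *; lia].
- rewrite /wing bodyE; have -> : (m - 1 - (m - 2) = 1)%N by lia.
  by rewrite /= /f /=; congr ((_, _) :: _); lia.
- rewrite /wing bodyE; have -> : (m - 1 - (m - 2) = 1)%N by lia.
  by rewrite /= /f /=; congr ((_, _) :: _); lia.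
- by move=> x; rewrite in_cons mem_cat !in_cons !mem_iota; lia.
- case=> x y; rewrite mem_cross_arcs // mem_rcons in_cons mem_cat.
  rewrite (@mem_cycle_arcs_cons_iota 1 2 4) ?(@mem_cycle_arcs_cons_iota 1 3 4); try lia.
  rewrite xpair_eqE m_ge4; case: (ltngtP x 1%N) => [?|?|->]; [lia| |lia].
  case: (ltngtP x 2) => [?|?|->]; [lia| |lia].
  by case: (ltngtP x 3) => [?|?|->]; lia.
Qed.

Lemma eared_butterfly_iso3 :
  digraph_iso (eared_butterfly Body 2 W1 m 0 m (m - 1) (m - 1))
    (cross_chorded m).
Proof.
(* The head is now [v_2]. The cycles are [v_2 v_3 v_4 ... v_m v_1] and [v_2 v_4 ... v_m v_1]; the
   ear is the chord from [v_1] to [v_3]. *)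
pose f k : butterfly_label :=
  if k == 1%N then (Body, 2) else if k == 2%N then hd1
  else if k == 3%N then (W1, m) else (Body, (m + 3 - k)%N).
have bodyE : body (m - 1) = map f (rcons (iota 4 (m - 3)) 1%N).
  rewrite /body; have -> : (m - 1).-1 = (m - 3).+1 by lia.
  rewrite /= rev_cons !map_rcons; congr rcons.
  rewrite (rev_iota_map _ 4) -map_comp.
  apply/eq_in_map => k; rewrite mem_iota => hk; rewrite /f /=.
  have -> : (k == 1)%N = false by lia.
  have -> : (k == 2)%N = false by lia.
  have -> : (k == 3)%N = false by lia.
  congr (_, _); lia.
apply: (@eared_butterfly_iso f _ _ _ _ _ _ _ 2 1 3
  (3 :: rcons (iota 4 (m - 3)) 1%N) (rcons (iota 4 (m - 3)) 1%N)) => //.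
- move=> x y; rewrite !mem_iota /f /hd1 => hx hy.
  by do !case: ifP => ?; first [lia | move=> [] *; lia].
- rewrite /wing bodyE; have -> : (m - (m - 1) = 1)%N by lia.
  by rewrite /= /f /=; congr ((_, _) :: _); lia.
- rewrite /wing bodyE; have -> : (m - 1 - (m - 1) = 0)%N by lia.
  by [].
- by move=> x; rewrite in_cons mem_cat in_cons !mem_rcons !in_cons !mem_iota; lia.
- case=> x y; rewrite mem_cross_arcs // mem_rcons in_cons mem_cat.
  rewrite -[3 :: rcons _ _]/(rcons (iota 3 (m - 3).+1) 1%N).
  rewrite (@mem_cycle_arcs_iota_rcons 2 1 3) ?(@mem_cycle_arcs_iota_rcons 2 1 4); try lia.
  rewrite xpair_eqE m_ge4; case: (ltngtP x 1%N) => [?|?|->]; [lia| |lia].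
  case: (ltngtP x 2) => [?|?|->]; [lia| |lia].
  by case: (ltngtP x 3) => [?|?|->]; lia.
Qed.

End EaredButterflies.

(** * Classification *)

Section CycleLabel.
Set Implicit Arguments.
Unset Strict Implicit.
Variable m : nat.
Hypothesis m_ge3 : (3 <= m)%N.

(* The index in C_m^x of the vertex at distance k from v_1 along the path
   v_3 -> ... -> v_m -> v_1. *)
Definition cycle_label (k : nat) : nat := if k is 0 then 1%N else (m - k.-1)%N.

Lemma cycle_label_bounds k : (k < m.-1)%N ->
  (0 < cycle_label k <= m)%N /\ cycle_label k != 2%N.
Proof. by case: k => [|k] /= km; split; lia. Qed.

Lemma cycle_label_inj k l : (k < m.-1)%N -> (l < m.-1)%N ->
  cycle_label k = cycle_label l -> k = l.
Proof. by case: k l => [|k] [|l] /=; lia. Qed.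

Lemma cycle_label_step k : (k.+1 < m.-1)%N ->
  (cycle_label k.+1, cycle_label k) \in cross_arcs m.
Proof. by rewrite mem_cross_arcs //; case: k => [|k] /= km; lia. Qed.

Lemma cycle_label_v1 : (1%N, 2) \in cross_arcs m.
Proof. by rewrite mem_cross_arcs //; lia. Qed.

Lemma cycle_label_v1_v3 k : k.+1 = m.-1 -> (1%N, cycle_label k) \in cross_arcs m.
Proof. by rewrite mem_cross_arcs //; case: k => [|k] /= km; lia. Qed.

Lemma cycle_label_v2_v3 k : k.+1 = m.-1 -> (2, cycle_label k) \in cross_arcs m.
Proof. by rewrite mem_cross_arcs //; case: k => [|k] /= km; lia. Qed.

Lemma cycle_label_v2_v4 k : k.+2 = m.-1 -> (2, cycle_label k) \in cross_arcs m.
Proof. by rewrite mem_cross_arcs //; case: k => [|k] /= km; case: ifP; lia. Qed.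

End CycleLabel.

Section Classification.
Set Implicit Arguments.
Unset Strict Implicit.
Variables (R : realType) (m : nat) (z : R).
Hypotheses (m_ge3 : (3 <= m)%N) (z01 : 0 < z < 1).
Hypothesis zm : z ^+ m + 2 * z ^+ m.-1 = 1.
Variable G : digraph.
Hypotheses (Gsc : strongly_connected G) (Gm : #|G| = m) (GE : #|edges G| = (m + 2)%N).

Let z_gt0 : 0 < z. Proof. by case/andP: z01. Qed.

(** The common outcome of all cases: [y] always gives the lower bound [1/z], and equality can
    survive only in the last two alternatives. *)
Definition minimal_or_strict : Prop := exists y : G -> R,
  [/\ forall x, 0 < y x, forall x, z^-1 * y x <= out_sum y x &
   [\/ exists x, z^-1 * y x < out_sum y x, digraph_iso G (cross_chorded m) |
     m = 3%N /\ digraph_iso G (eared_butterfly W1 2 W1 3 0 3 1 1)]].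

(** The basin of [u] is the whole vertex set, so its three successors weigh at least
    [z^m + z^(m-1) + z^(m-2)]. *)
Lemma one_branching_vertex (u : G) : #|out u| = 3%N ->
  (forall x, x != u -> #|out x| = 1%N) -> minimal_or_strict.
Proof.
move=> u3 out1.
have [|x|d [t dt]] := @descent_exists G [set u].
- by move=> x; rewrite inE => xu; apply: out_card1; exact: out1.
- by exists u; rewrite ?set11.
have tu x : t x = u by apply/set1P; exact: descent_mem dt x.
have Bu : #|basin t u| = m by rewrite -Gm; apply: eq_card => x; rewrite inE tu eqxx.
have outB : out u \subset basin t u by apply/subsetP => x _; rewrite inE tu.
have [le_w _] := basin_weight dt z01 outB.
rewrite u3 !big_ord_recr big_ord0 /= add0r subn0 Bu subn1 in le_w.
have w_gt1 := lt_le_trans (root_consecutive_powers m_ge3 z01 zm) le_w.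
have sumE : \sum_(w in out u) z ^+ (d w).+1 * (fun=> 1) (t w) = weight d z (out u).
  by apply: eq_bigr => w _; rewrite mulr1.
have [|y0|y [y_gt0 Ay strict]] := potential_subinvariant z_gt0 dt (c := fun=> 1).
- by [].
- by move=> /set1P->; rewrite sumE ltW.
- exists y; split=> //; apply: Or31; apply: strict.
  by exists u; rewrite ?set11 ?sumE.
Qed.

Section TwoBranchingVertices.
Variables (u v : G) (d : G -> nat) (t : G -> G).
Hypotheses (uv : u != v) (out_u : #|out u| = 2%N) (out_v : #|out v| = 2%N).
Hypothesis dt : descent [set u; v] d t.

Let N (x y : G) : {set G} := out x :&: basin t y.

Let t_uv x : t x = u \/ t x = v.
Proof. by have := descent_mem dt x; rewrite !inE => /orP[]/eqP; [left|right]. Qed.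

Lemma card_basins : (#|basin t u| + #|basin t v|)%N = m.
Proof.
rewrite -Gm -cardsT -(cardsID (basin t u) [set: G]) setTI setTD; congr addn.
apply: eq_card => x; rewrite !inE; have [->|->] := t_uv x.
  by rewrite eqxx (negPf uv).
by rewrite eqxx eq_sym uv.
Qed.

Lemma card_N x : (#|N x u| + #|N x v|)%N = #|out x|.
Proof.
rewrite -(cardsID (basin t u) (out x)); congr addn.
apply: eq_card => w; rewrite !inE; have [->|->] := t_uv w.
  by rewrite eqxx (negPf uv) andbF.
by rewrite eqxx eq_sym uv andbT.
Qed.

Lemma sum_out_N (c : G -> R) x : \sum_(w in out x) z ^+ (d w).+1 * c (t w) =
  weight d z (N x u) * c u + weight d z (N x v) * c v.
Proof.
rewrite (big_setID (basin t u)) /=; congr (_ + _); rewrite /weight mulr_suml.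
  by apply: eq_bigr => w; rewrite !inE => /andP[_ /eqP->].
apply: eq_big => w; rewrite !inE.
  have [->|->] := t_uv w; first by rewrite eqxx (negPf uv) andbF.
  by rewrite eqxx eq_sym uv andbT.
by have [->|->] := t_uv w; rewrite ?eqxx.
Qed.

(** Otherwise the basin of [u] would be closed under edges, and strong connectedness would put [v]
    into it. *)
Lemma N_uv_gt0 : (0 < #|N u v|)%N.
Proof.
rewrite lt0n; apply/negP => /eqP/cards0_eq N0.
have : t v == u; last first.
  have vS : v \in [set u; v] by rewrite !inE eqxx orbT.
  by have [_ ->] := descent_stop dt vS; rewrite eq_sym (negPf uv).
apply: (@connect_invariant G (@edge G) (fun x => t x == u) u v _ (Gsc u v)).
  move=> x w /eqP tx xw; have [xS|xS] := boolP (x \in [set u; v]).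
    have [_ xE] := descent_stop dt xS; rewrite tx in xE.
    have [->|tw] := t_uv w; first exact: eqxx.
    have : w \in N u v by rewrite !inE xE xw tw eqxx.
    by rewrite N0 inE.
  have [w' [xE _ tw]] := descent_step dt xS.
  by move: xw; rewrite xE => /eqP ->; rewrite -tw tx.
have uS : u \in [set u; v] by rewrite !inE eqxx.
by have [_ ->] := descent_stop dt uS.
Qed.

Lemma N_weight x y : \sum_(i < #|N x y|) z ^+ (#|basin t y| - i) <= weight d z (N x y) /\
  (weight d z (N x y) = \sum_(i < #|N x y|) z ^+ (#|basin t y| - i) ->
   forall i, (i < #|N x y|)%N ->
     exists2 w, w \in N x y & ((d w).+1 + i = #|basin t y|)%N).
Proof. exact: (basin_weight dt z01 (subsetIr _ _)). Qed.

Let du : d u = 0%N /\ t u = u.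
Proof. by apply: (descent_stop dt); rewrite !inE eqxx. Qed.

Let dv : d v = 0%N /\ t v = v.
Proof. by apply: (descent_stop dt); rewrite !inE eqxx orbT. Qed.

(** The basin of [v] is [v] alone, and the basin of [u] has [m - 1] vertices on distinct levels,
    hence is a single path to [u]. With [u] as [v_1] and [v] as [v_2], its top is [v_3]; [s] and
    [s1] sit there, and [s2] one level below. *)
Lemma cross_chorded_of_descent s s1 s2 : #|basin t v| = 1%N ->
  N v v = set0 -> #|N u u| = 1%N ->
  s \in N u u -> (d s).+1 = m.-1 -> s1 \in N v u -> (d s1).+1 = m.-1 ->
  s2 \in N v u -> (d s2).+2 = m.-1 -> digraph_iso G (cross_chorded m).
Proof.
move=> Bv Nvv Nuu sN ds s1N ds1 s2N ds2.
have BvE x : t x = v -> x = v.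
  have /cards1P[w BvE] : #|basin t v| == 1%N by rewrite Bv.
  have xw y : t y = v -> y = w.
    by move=> ty; apply/set1P; rewrite -BvE inE ty.
  by move=> /xw ->; rewrite (xw v) //; case: dv.
have tu x : x != v -> t x = u.
  by move=> xv; have [//|/BvE xE] := t_uv x; rewrite xE eqxx in xv.
have Bu : #|basin t u| = (d s).+1 by have := card_basins; lia.
have d_inj : {in basin t u &, injective d}.
  by apply: (basin_level_inj dt) Bu; move: sN; rewrite !inE => /andP[_ /eqP].
have d_lt x : t x = u -> (d x < m.-1)%N.
  move=> tx; have xB : [set x] \subset basin t u by rewrite sub1set inE tx.
  have := basin_level_card dt xB (set11 x) (k := d x).
  by rewrite cards1 Bu ds addn1; apply=> y /set1P->.
pose f x := if x == v then 2%N else cycle_label m (d x).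
have fv : f v = 2%N by rewrite /f eqxx.
have fu x : t x = u -> f x = cycle_label m (d x).
  move=> tx; rewrite /f; have [xv|//] := eqVneq x v.
  by case/eqP: uv; rewrite -tx xv; case: dv.
have NvuE y : y \in N v u -> y = s1 \/ y = s2.
  have s12 : s1 != s2 by apply/eqP => s12; move: ds2; rewrite -s12; lia.
  have /eqP <- : [set s1; s2] == N v u.
    rewrite eqEcard subUset !sub1set s1N s2N cards2 s12 /=.
    by have := card_N v; rewrite Nvv cards0 out_v; lia.
  by rewrite !inE => /orP[]/eqP; [left|right].
have NuuE y : y \in N u u -> y = s.
  have /cards1P[w NE] : #|N u u| == 1%N by rewrite Nuu.
  by move: sN; rewrite NE => /set1P-> /set1P.
apply: (@digraph_iso_labelling _ (Presentation (iota 1 m) (cross_arcs m)) _ f).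
- move=> x y; have [->|xv] := eqVneq x v; have [->|yv] := eqVneq y v => //.
  + rewrite fv (fu y (tu y yv)) => /esym/eqP.
    by rewrite (negPf (proj2 (cycle_label_bounds m_ge3 (d_lt y (tu y yv))))).
  + rewrite fv (fu x (tu x xv)) => /eqP.
    by rewrite (negPf (proj2 (cycle_label_bounds m_ge3 (d_lt x (tu x xv))))).
  + have hx := tu x xv; have hy := tu y yv; rewrite !fu // => fxy.
    apply: d_inj; rewrite ?inE ?hx ?hy //.
    exact: cycle_label_inj (d_lt x hx) (d_lt y hy) fxy.
- move=> x /=; have [->|xv] := eqVneq x v; first by rewrite fv cross_vertexP; lia.
  rewrite fu ?tu // cross_vertexP //.
  exact: (proj1 (cycle_label_bounds m_ge3 (d_lt x (tu x xv)))).
- move=> x y xy; have [xE|xv] := eqVneq x v.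
    have yN : y \in N v u.
      rewrite !inE -xE xy /=; apply/eqP; have [//|ty] := t_uv y.
      have : y \in N v v by rewrite !inE -xE xy xE ty eqxx.
      by rewrite Nvv inE.
    have ty : t y = u by move: yN; rewrite !inE => /andP[_ /eqP].
    rewrite xE fv fu //; case: (NvuE y yN) => ->.
      exact: cycle_label_v2_v3.
    exact: cycle_label_v2_v4.
  have [xE|xu] := eqVneq x u.
    rewrite xE fu ?(proj2 du) // (proj1 du).
    have [ty|ty] := t_uv y; last by rewrite (BvE y ty) fv; exact: cycle_label_v1.
    have yN : y \in N u u by rewrite !inE -xE xy xE ty eqxx.
    by rewrite fu // (NuuE y yN); exact: cycle_label_v1_v3.
  have xS : x \notin [set u; v] by rewrite !inE negb_or xu xv.
  have [w [xE dx tx]] := descent_step dt xS.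
  move: xy; rewrite xE => /eqP->.
  have tw : t w = u by rewrite -tx tu.
  have := d_lt x (tu x xv); rewrite (fu w tw) (fu x (tu x xv)) dx.
  exact: cycle_label_step.
- by rewrite Gm card_cross_chorded.
- by rewrite GE card_edges_cross_chorded.
Qed.

(** Giving [u] the value 1 and [v] the weight [c] of its successors makes the inequality at [v] an
    equality; what remains at [u] is [1 <= a + b c]. *)
Lemma no_return_to_v : N v v = set0 -> minimal_or_strict.
Proof.
move=> Nvv; have z_lt1 : z < 1 by case/andP: z01.
have pqm := card_basins; set p := #|basin t u| in pqm *; set q := #|basin t v| in pqm *.
have nvu : #|N v u| = 2%N by have := card_N v; rewrite Nvv cards0 addn0 out_v.
have p_ge2 : (2 <= p)%N by rewrite -nvu; apply: subset_leq_card; exact: subsetIr.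
have nuv := N_uv_gt0; have nuu := card_N u; rewrite out_u in nuu.
have q_gt0 : (0 < q)%N.
  by apply: leq_trans nuv _; apply: subset_leq_card; exact: subsetIr.
have [lvu evu] := N_weight v u; have [luv euv] := N_weight u v.
have [luu euu] := N_weight u u.
rewrite nvu !big_ord_recr big_ord0 /= add0r subn0 -/p subn1 in lvu evu.
set a := weight d z (N u u) in luu euu *; set b := weight d z (N u v) in luv euv *.
set c := weight d z (N v u) in lvu evu *.
have zp := exprn_gt0 p z_gt0; have zp1 := exprn_gt0 p.-1 z_gt0.
have zq := exprn_gt0 q z_gt0.
have zpq : z ^+ p * z ^+ q = z ^+ m by rewrite -exprD pqm.
have zp1q : z ^+ p.-1 * z ^+ q = z ^+ m.-1.
  by rewrite -exprD; congr (_ ^+ _); move: pqm p_ge2; clear; lia.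
have c_gt0 : 0 < c by lra.
have key : 1 <= a + b * c /\ (a + b * c = 1 -> digraph_iso G (cross_chorded m)).
  have [nuv2|nuv1] : #|N u v| = 2%N \/ #|N u v| = 1%N by move: nuu nuv; clear; lia.
    have nuu0 : #|N u u| = 0%N by move: nuu nuv2; clear; lia.
    rewrite nuv2 !big_ord_recr big_ord0 /= add0r subn0 -/q subn1 in luv.
    rewrite nuu0 big_ord0 in luu.
    have zq1 := exprn_gt0 q.-1 z_gt0.
    have zpq1 : z ^+ p * z ^+ q.-1 = z ^+ m.-1.
      by rewrite -exprD; congr (_ ^+ _); move: pqm q_gt0; clear; lia.
    have bc : (z ^+ q + z ^+ q.-1) * (z ^+ p + z ^+ p.-1) <= b * c.
      by apply: ler_pM => //; rewrite addr_ge0 // ltW.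
    have zp1q1 : 0 < z ^+ p.-1 * z ^+ q.-1 by rewrite mulr_gt0.
    (* Both successors of [u] are led to [v]: the product expands to [z^m + 2 z^(m-1)] plus a
       positive term. *)
    have gt1 : 1 < (z ^+ q + z ^+ q.-1) * (z ^+ p + z ^+ p.-1).
      have -> : (z ^+ q + z ^+ q.-1) * (z ^+ p + z ^+ p.-1) = z ^+ p * z ^+ q +
        z ^+ p.-1 * z ^+ q + z ^+ p * z ^+ q.-1 + z ^+ p.-1 * z ^+ q.-1 by ring.
      rewrite zpq zp1q zpq1; move: zm zp1q1.
      by move: (z ^+ m) (z ^+ m.-1) (z ^+ p.-1 * z ^+ q.-1) => A B C; lra.
    have abc_gt1 : 1 < a + b * c by lra.
    by split=> [|abc]; [exact: ltW|rewrite abc ltxx in abc_gt1].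
  have nuu1 : #|N u u| = 1%N by move: nuu nuv1; clear; lia.
  rewrite nuv1 big_ord_recr big_ord0 /= add0r subn0 -/q in luv euv.
  rewrite nuu1 big_ord_recr big_ord0 /= add0r subn0 -/p in luu euu.
  have zpm : z ^+ m.-1 <= z ^+ p.
    by apply: ler_wiXn2l; rewrite ?ltW //; move: pqm q_gt0; clear; lia.
  have bc : z ^+ q * (z ^+ p + z ^+ p.-1) <= b * c.
    by apply: ler_pM; rewrite ?addr_ge0 // ltW.
  have zsum : z ^+ q * (z ^+ p + z ^+ p.-1) = z ^+ m + z ^+ m.-1.
    by rewrite mulrDr ![z ^+ q * _]mulrC zpq zp1q.
  rewrite zsum in bc.
  (* The bound is [z^p + z^m + z^(m-1)] with [p <= m - 1]. Reaching 1 forces [p = m - 1] and minimal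
     weights, which fix the levels of all the successors involved. *)
  have [aE bE] : 1 <= a + b * c /\ (a + b * c = 1 ->
      [/\ a = z ^+ p, z ^+ p = z ^+ m.-1 & b * c = z ^+ m + z ^+ m.-1]).
    move: (b * c) bc zm zpm luu => B.
    by move: (z ^+ m) (z ^+ m.-1) (z ^+ p) => M M1 P *; split=> [|*]; [|split]; lra.
  split=> // /bE[{}aE zpE {}bE].
  have cE : c = z ^+ p + z ^+ p.-1.
    apply/eqP; rewrite eq_le lvu andbT -(ler_pM2l zq) zsum -bE.
    by rewrite ler_pM2r.
  have pE : p = m.-1.
    exact: (ieexprIn z_gt0 (negbT (lt_eqF z_lt1))).
  have [s sN ds] := euu aE 0%N isT.
  have [s1 s1N ds1] := evu cE 0%N isT.
  have [s2 s2N ds2] := evu cE 1%N isT.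
  apply: (@cross_chorded_of_descent s s1 s2) => //.
  - by move: pqm pE m_ge3; rewrite -/q; clear; lia.
  - by move: ds pE; rewrite -/p; clear; lia.
  - by move: ds1 pE; rewrite -/p; clear; lia.
  - by move: ds2 pE; rewrite -/p; clear; lia.
pose e x := if x == v then c else 1.
have ev : e v = c by rewrite /e eqxx.
have eu : e u = 1 by rewrite /e (negPf uv).
have S_v : \sum_(w in out v) z ^+ (d w).+1 * e (t w) = c.
  by rewrite sum_out_N Nvv /weight big_set0 mul0r addr0 eu mulr1.
have S_u : \sum_(w in out u) z ^+ (d w).+1 * e (t w) = a + b * c.
  by rewrite sum_out_N ev eu mulr1.
have [x _|x|y [y_gt0 Ay strict]] := potential_subinvariant z_gt0 dt (c := e).
- by rewrite /e; case: ifP.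
- by rewrite !inE => /orP[]/eqP->; rewrite ?S_u ?S_v ?eu ?ev //; case: key.
exists y; split=> //; have [ge1 eq1] := key.
have [/esym/eq1|ne1] := eqVneq 1 (a + b * c); first by apply: Or32.
apply: Or31; apply: strict; exists u; first by rewrite !inE eqxx.
by rewrite S_u eu lt_neqAle ne1.
Qed.

(** The basin of [u] is [u] alone, so [u] carries a loop and becomes [h_1]. The basin of [v] is the
    path from [w] to [v], which become [w_3] and [w_2]; the successors of [u] and [v] led to [v]
    both lie at its top. *)
Lemma D3_of_descent w w' : m = 3%N -> #|basin t u| = 1%N ->
  #|N u u| = 1%N -> #|N u v| = 1%N -> #|N v u| = 1%N -> #|N v v| = 1%N ->
  w \in N u v -> d w = 1%N -> w' \in N v v -> d w' = 1%N ->
  digraph_iso G (eared_butterfly W1 2 W1 3 0 3 1 1).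
Proof.
move=> m3 Bu Nuu Nuv Nvu Nvv wN dw w'N dw'.
have N1 x y a b : #|N x y| = 1%N -> a \in N x y -> b \in N x y -> a = b.
  by move=> /eqP/cards1P[e ->] /set1P-> /set1P->.
have BuE x : t x = u -> x = u.
  have /cards1P[e BE] : #|basin t u| == 1%N by rewrite Bu.
  have xe y : t y = u -> y = e.
    by move=> ty; apply/set1P; rewrite -BE inE ty.
  by move=> /xe ->; rewrite (xe u) //; case: du.
have tv x : x != u -> t x = v.
  by move=> xu; have [/BuE xE|//] := t_uv x; rewrite xE eqxx in xu.
have tw : t w = v by move: wN; rewrite !inE => /andP[_ /eqP].
have Bv : #|basin t v| = (d w).+1 by have := card_basins; rewrite Bu dw m3 => -[].
have d_inj : {in basin t v &, injective d} by exact: (basin_level_inj dt) Bv.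
have d_le x : t x = v -> (d x <= 1)%N.
  move=> tx; have xB : [set x] \subset basin t v by rewrite sub1set inE tx.
  have := basin_level_card dt xB (set11 x) (k := d x).
  by rewrite cards1 Bv dw addn1 ltnS; apply=> y /set1P->.
have d_other x : x != u -> x != v -> d x = 1%N.
  move=> xu xv; have := d_le x (tv x xu); case dx: (d x) => [|[|//]] // _.
  by have := descent0 dt dx; rewrite tv // => vx; rewrite vx eqxx in xv.
have not_u x : d x = 1%N -> x != u.
  by move=> dx; apply/eqP => xu; move: dx; rewrite xu (proj1 du).
have not_v x : d x = 1%N -> x != v.
  by move=> dx; apply/eqP => xv; move: dx; rewrite xv (proj1 dv).
pose f x : butterfly_label + nat :=
  inl (if x == u then hd1 else if x == v then (W1, 2) else (W1, 3%N)).
have fu : f u = inl hd1 by rewrite /f eqxx.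
have fv : f v = inl (W1, 2) by rewrite /f eq_sym (negPf uv) eqxx.
have fo x : d x = 1%N -> f x = inl (W1, 3%N).
  by move=> dx; rewrite /f (negPf (not_u x dx)) (negPf (not_v x dx)).
apply: (@digraph_iso_labelling _ (insert_ear 0 (W1, 2) (W1, 3) (butterfly 3 1 1)) _ f).
- move=> x y; have [->|xu] := eqVneq x u; have [->|yu] := eqVneq y u => //.
  + by rewrite fu /f (negPf yu); case: ifP.
  + by rewrite fu /f (negPf xu); case: ifP.
  have [->|xv] := eqVneq x v; have [->|yv] := eqVneq y v => //.
  + by rewrite fv (fo y (d_other y yu yv)).
  + by rewrite fv (fo x (d_other x xu xv)).
  by move=> _; apply: d_inj; rewrite ?inE ?tv ?d_other.
- by move=> x; rewrite /f; case: ifP => // _; case: ifP.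
- move=> x y xy; have [xE|xu] := eqVneq x u.
    rewrite xE in xy *; have [ty|ty] := t_uv y; first by rewrite (BuE y ty) fu.
    have yN : y \in N u v by rewrite !inE xy ty eqxx.
    by rewrite fu (N1 _ _ _ _ Nuv yN wN) fo.
  have [xE|xv] := eqVneq x v.
    rewrite xE in xy *; have [ty|ty] := t_uv y; first by rewrite (BuE y ty) fu fv.
    have yN : y \in N v v by rewrite !inE xy ty eqxx.
    by rewrite fv (N1 _ _ _ _ Nvv yN w'N) fo.
  have xS : x \notin [set u; v] by rewrite !inE negb_or xu xv.
  have [y' [xE dx tx]] := descent_step dt xS.
  move: xy; rewrite xE => /eqP->.
  have dy : d y' = 0%N by move: dx; rewrite d_other // => -[].
  by rewrite -(descent0 dt dy) -tx tv // fv fo // d_other.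
- by rewrite Gm m3 card_D3.
- by rewrite GE m3 card_edges_D3.
Qed.

(** With the constant value 1, each branching vertex has one successor led to [u] and one led to
    [v], so both sums are at least [z^p + z^q]. *)
Lemma all_return : (#|basin t u| <= #|basin t v|)%N ->
  #|N u u| = 1%N -> #|N u v| = 1%N -> #|N v u| = 1%N -> #|N v v| = 1%N ->
  minimal_or_strict.
Proof.
move=> pq Nuu Nuv Nvu Nvv.
have pqm := card_basins.
set p := #|basin t u| in pqm pq *; set q := #|basin t v| in pqm pq *.
have p_gt0 : (0 < p)%N.
  by apply/card_gt0P; exists u; rewrite inE (proj2 du).
have weight1 x y : #|N x y| = 1%N -> z ^+ #|basin t y| <= weight d z (N x y) /\
    (weight d z (N x y) = z ^+ #|basin t y| ->
     exists2 w, w \in N x y & (d w).+1 = #|basin t y|).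
  move=> Nxy; have := N_weight x y; rewrite Nxy big_ord_recr big_ord0 /= add0r subn0.
  move=> [le_w eq_w]; split=> // /eq_w/(_ 0%N isT)[w wN dw].
  by exists w; rewrite // -dw addn0.
have [luu euu] := weight1 u u Nuu; have [luv euv] := weight1 u v Nuv.
have [lvu evu] := weight1 v u Nvu; have [lvv evv] := weight1 v v Nvv.
have pq1 : 1 <= z ^+ p + z ^+ q /\ (z ^+ p + z ^+ q = 1 -> m = 3%N).
  have [m4|m3] := leqP 4 m.
    have gt1 := root_two_powers m_ge3 z01 zm m4 pqm.
    by split=> [|eq1]; [exact: ltW|rewrite eq1 ltxx in gt1].
  have mE : m = 3%N by move: m_ge3 m3; clear; lia.
  (* With [p <= q] the only splitting of 3 is [1 + 2], where the sum is exactly 1. *)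
  split=> //; have -> : p = 1%N by move: pq pqm p_gt0; rewrite mE; clear; lia.
  have -> : q = 2%N by move: pq pqm p_gt0; rewrite mE; clear; lia.
  by rewrite expr1 (root_three z01 zm mE).
pose e (x : G) : R := 1.
have S_u : \sum_(w in out u) z ^+ (d w).+1 * e (t w) =
    weight d z (N u u) + weight d z (N u v) by rewrite sum_out_N !mulr1.
have S_v : \sum_(w in out v) z ^+ (d w).+1 * e (t w) =
    weight d z (N v u) + weight d z (N v v) by rewrite sum_out_N !mulr1.
have [pq_ge1 pq_eq1] := pq1.
have [//|x|y [y_gt0 Ay strict]] := potential_subinvariant z_gt0 dt (c := e).
- by rewrite !inE => /orP[]/eqP->; rewrite ?S_u ?S_v;
    apply: le_trans pq_ge1 _; apply: lerD.
exists y; split=> //.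
have [lt_u|ge_u] := ltP 1 (weight d z (N u u) + weight d z (N u v)).
  by apply: Or31; apply: strict; exists u; rewrite ?S_u // !inE eqxx.
have [lt_v|ge_v] := ltP 1 (weight d z (N v u) + weight d z (N v v)).
  by apply: Or31; apply: strict; exists v; rewrite ?S_v // !inE eqxx orbT.
(* If neither sum exceeds 1, all the bounds are attained, so the successors led to [v] lie on the
   top level [q - 1]. *)
have m3 : m = 3%N.
  apply: pq_eq1; apply/eqP; rewrite eq_le pq_ge1 andbT.
  by apply: le_trans ge_u; apply: lerD.
have pE : p = 1%N by move: pq pqm p_gt0; rewrite m3; clear; lia.
have qE : q = 2%N by move: pq pqm p_gt0; rewrite m3; clear; lia.
have [w wN dw] : exists2 w, w \in N u v & (d w).+1 = q.
  apply: euv; apply/eqP; rewrite eq_le luv andbT.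
  by move: pq_ge1 luu ge_u; rewrite -/p -/q; lra.
have [w' w'N dw'] : exists2 w, w \in N v v & (d w).+1 = q.
  apply: evv; apply/eqP; rewrite eq_le lvv andbT.
  by move: pq_ge1 lvu ge_v; rewrite -/p -/q; lra.
apply: Or33; split=> //; rewrite qE in dw dw'.
by case: dw => dw; case: dw' => dw'; exact: (@D3_of_descent w w').
Qed.

End TwoBranchingVertices.

(** The situation is symmetric in [u] and [v]: a vertex without return plays the role of [v];
    otherwise the one with the smaller basin plays that of [u]. *)
Lemma minimal_or_strictP : minimal_or_strict.
Proof.
have G_gt1 : (1 < #|G|)%N by rewrite Gm; apply: ltnW.
have EG : #|edges G| = (#|G| + 2)%N by rewrite GE Gm.
have [[u [u3 out1]]|[u [v [uv out_u out_v out1]]]] := out_degrees Gsc G_gt1 EG.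
  exact: one_branching_vertex u3 out1.
have vu : v != u by rewrite eq_sym.
have [||d [t dt]] := @descent_exists G [set u; v].
- by move=> x; rewrite !inE negb_or => /andP[xu xv]; apply: out_card1; exact: out1.
- by move=> x; exists u; rewrite ?inE ?eqxx.
have dt' : descent [set v; u] d t by rewrite setUC.
have Nu := card_N uv dt u; have Nv := card_N uv dt v.
have [Nvv|Nvv] := posnP #|out v :&: basin t v|.
  exact: (no_return_to_v uv out_u out_v dt (cards0_eq Nvv)).
have [Nuu|Nuu] := posnP #|out u :&: basin t u|.
  exact: (no_return_to_v vu out_v out_u dt' (cards0_eq Nuu)).
have Nuv := N_uv_gt0 uv dt; have Nvu := N_uv_gt0 vu dt'.
rewrite out_u in Nu; rewrite out_v in Nv.
have [pq|/ltnW qp] := leqP #|basin t u| #|basin t v|.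
  by apply: (all_return uv dt pq);
    move: Nu Nv Nvv Nuu Nuv Nvu; clear; lia.
by apply: (all_return vu dt' qp);
  move: Nu Nv Nvv Nuu Nuv Nvu; clear; lia.
Qed.

End Classification.

(** * The root of [Pmin] and its numerical bounds *)

Section Root.
Set Implicit Arguments.
Unset Strict Implicit.
Variables (R : realType) (m : nat).
Hypothesis m_ge3 : (3 <= m)%N.
Implicit Type z : R.

Lemma root_PminE z : root (Pmin R m) z = (z ^+ m + 2 * z ^+ m.-1 == 1).
Proof.
rewrite rootE /Pmin !hornerE eq_sym -[RHS]subr_eq0 -[RHS]oppr_eq0 eq_sym.
by congr (_ == 0); ring.
Qed.

Lemma Pmin_root_unique : exists z, unique (fun z => 0 < z < 1 /\ root (Pmin R m) z) z.
Proof.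
(* The negated polynomial goes from [-1] at 0 to [2] at 1. Uniqueness follows since
   [z^m + 2 z^(m-1)] is strictly increasing on nonnegative reals. *)
have [||z /andP[z_ge0 z_le1] rz] := @poly_ivt R (- Pmin R m) 0 1.
- exact: ler01.
- rewrite /Pmin !hornerE !expr1n !expr0n /=.
  have -> : (m == 0)%N = false by lia.
  have -> : (m.-1 == 0)%N = false by lia.
  by rewrite ![false%:R]mulr0n; apply/andP; split; lra.
move: rz; rewrite rootN root_PminE => /eqP zm; exists z; split.
  rewrite root_PminE zm eqxx; split=> //; rewrite !lt_neqAle z_ge0 z_le1 !andbT eq_sym.
  apply/andP; split; apply/eqP => zE; move: zm; rewrite zE ?expr1n ?expr0n /=.
    have -> : (m == 0)%N = false by lia.
    have -> : (m.-1 == 0)%N = false by lia.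
    by rewrite ![false%:R]mulr0n; lra.
  by lra.
move=> x [/andP[x_gt0 _]]; rewrite root_PminE => /eqP xm.
have mono (a b : R) : 0 <= a -> 0 <= b -> a < b ->
    a ^+ m + 2 * a ^+ m.-1 < b ^+ m + 2 * b ^+ m.-1.
  move=> a0 b0 ab; rewrite ltrD // ?ltr_pM2l // ltrXn2r //; lia.
have [zx|xz|//] := ltgtP z x.
  by have := mono z x z_ge0 (ltW x_gt0) zx; rewrite zm xm ltxx.
by have := mono x z (ltW x_gt0) z_ge0 xz; rewrite zm xm ltxx.
Qed.

(** Dividing the equation by [z^(m-1)] gives [(1/z)^(m-1) = 2 + z], which lies strictly between 2
    and 3. *)
Lemma Pmin_root_powR_bounds z : 0 < z < 1 -> z ^+ m + 2 * z ^+ m.-1 = 1 ->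
  2 `^ (m.-1%:R^-1) < z^-1 < 3 `^ (m.-1%:R^-1).
Proof.
move=> /andP[z_gt0 z_lt1] zm.
have m1_gt0 : 0 < (m.-1%:R : R) by rewrite ltr0n; lia.
have zE : z^-1 = (2 + z) `^ (m.-1%:R^-1).
  have -> : 2 + z = z^-1 ^+ m.-1.
    have z1_neq0 : z ^+ m.-1 != 0 by rewrite expf_neq0 // gt_eqF.
    apply: (mulIf z1_neq0); rewrite exprVn mulVf // -[RHS]zm mulrDl -exprS.
    have -> : m.-1.+1 = m by lia.
    by rewrite addrC.
  rewrite -powR_mulrn ?invr_ge0 ?ltW // -powRrM mulfV ?gt_eqF // powRr1 //.
  by rewrite invr_ge0 ltW.
by rewrite zE !gt0_ltr_powR ?invr_gt0 ?nnegrE //; lra.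
Qed.

Lemma golden_inverse z : 0 < z < 1 -> z + z ^+ 2 = 1 ->
  z^-1 = (1 + Num.sqrt 5) / 2.
Proof.
move=> /andP[z_gt0 z_lt1] z2; have z_neq0 := lt0r_neq0 z_gt0.
have zE : z^-1 = 1 + z.
  by apply: (mulfI z_neq0); rewrite mulfV // -[LHS]z2; ring.
(* Completing the square: [(2 z + 1)^2 = 4 (z + z^2) + 1 = 5]. *)
have -> : Num.sqrt 5 = 2 * z + 1.
  have -> : 5 = (2 * z + 1) ^+ 2 by move: z2; rewrite !expr2; lra.
  by rewrite sqrtr_sqr ger0_norm // addr_ge0 // mulr_ge0 // ltW.
rewrite zE; lra.
Qed.

End Root.

(** * Lower bound, attainment and the cases of equality *)

Theorem theorem5p14 (R : realType) (m : nat) (hm : (3 <= m)%N) :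
  exists Rm : R,
    unique (fun z : R => 0 < z < 1 /\ root (Pmin R m) z) Rm /\
    (forall G : digraph, SC (m + 2) m G -> Rm^-1 <= rho R G) /\
    is_min_rho (SC (m + 2) m) Rm^-1 /\
    SC (m + 2) m (cross_chorded m) /\
    rho R (cross_chorded m) = Rm^-1 /\
    2 `^ (m.-1%:R^-1) < rho R (cross_chorded m) < 3 `^ (m.-1%:R^-1) /\
    ((4 <= m)%N ->
      (forall G : digraph, SC (m + 2) m G ->
        (rho R G = Rm^-1 <-> digraph_iso G (cross_chorded m))) /\
      digraph_iso (eared_butterfly W1 m Body (m - 2) 0 m (m - 1) (m - 1))
        (cross_chorded m) /\
      digraph_iso (eared_butterfly W1 (m - 1) W2 (m - 1) 0
          (m - 1) (m - 1) (m - 2))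
        (cross_chorded m) /\
      digraph_iso (eared_butterfly Body 2 W1 m 0 m (m - 1) (m - 1))
        (cross_chorded m)) /\
    (m = 3%N ->
      (forall G : digraph, SC 5 3 G ->
        (rho R G = Rm^-1 <->
          digraph_iso G (cross_chorded 3) \/
          digraph_iso G (eared_butterfly W1 2 W1 3 0 3 1 1))) /\
      rho R (cross_chorded 3) = (1 + Num.sqrt 5) / 2 /\
      rho R (eared_butterfly W1 2 W1 3 0 3 1 1) = (1 + Num.sqrt 5) / 2 /\
      ~ digraph_iso (eared_butterfly W1 2 W1 3 0 3 1 1) (cross_chorded 3)).
Proof.
have [z z_unique] := Pmin_root_unique R hm; exists z; split=> //.
have [[z01 /[!root_PminE]/eqP zm] _] := z_unique.
have z_gt0 : 0 < z by case/andP: z01.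
have card_G_gt0 G : SC (m + 2) m G -> (0 < #|G|)%N by move=> [-> _ _]; lia.
(* Strictness of the test function at some vertex would give [rho R G > z^-1], so equality leaves
   only the isomorphism alternatives. *)
have rho_cases G : SC (m + 2) m G -> z^-1 <= rho R G /\ (rho R G = z^-1 ->
    digraph_iso G (cross_chorded m) \/
    m = 3%N /\ digraph_iso G (eared_butterfly W1 2 W1 3 0 3 1 1)).
  move=> GSC; have [Gm GE Gsc] := GSC.
  have [y [y_gt0 Ay cases]] := minimal_or_strictP hm z01 zm Gsc Gm GE.
  have /card_gt0P[x0 _] := card_G_gt0 G GSC; split.
    apply: rho_ge Ay => [x|]; first exact: ltW.
    by exists x0.
  move=> rhoE; case: cases => [strict|isoG|isoG]; [|by left|by right].
  have : z^-1 < rho R G by apply: rho_gt strict; rewrite ?invr_ge0 // ltW.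
  by rewrite rhoE ltxx.
have iso_rho G : SC (m + 2) m G -> digraph_iso G (cross_chorded m) -> rho R G = z^-1.
  move=> GSC isoG; apply: rho_perron; first exact: card_G_gt0.
  by apply: perron_value_iso isoG _; exact: cross_chorded_perron.
have crossSC := cross_chorded_SC hm.
have rho_cross : rho R (cross_chorded m) = z^-1.
  apply: rho_perron; first exact: card_G_gt0.
  exact: cross_chorded_perron.
split; first by move=> G /rho_cases[].
split; first by split=> [|G /rho_cases[]//]; exists (cross_chorded m).
split=> //; split=> //; split; first by rewrite rho_cross; exact: Pmin_root_powR_bounds.
split=> [m4|m3].
  split; last by split; [exact: eared_butterfly_iso1|split;
    [exact: eared_butterfly_iso2|exact: eared_butterfly_iso3]].
  move=> G GSC; split=> [/(proj2 (rho_cases G GSC))[//|[m3 _]]|]; last exact: iso_rho.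
  by rewrite m3 in m4.
have z2 := root_three z01 zm m3.
have rho_D3 : rho R (eared_butterfly W1 2 W1 3 0 3 1 1) = z^-1.
  by apply: rho_perron; [rewrite card_D3|exact: D3_perron].
have rho_iso_D3 (G : digraph) : (0 < #|G|)%N ->
    digraph_iso G (eared_butterfly W1 2 W1 3 0 3 1 1) -> rho R G = z^-1.
  move=> G_gt0 isoG; apply: rho_perron => //.
  by apply: perron_value_iso isoG _; exact: D3_perron.
rewrite m3 in card_G_gt0 rho_cases iso_rho rho_cross.
split=> [G GSC|].
  split=> [/(proj2 (rho_cases G GSC))[|[_]]|[|]]; [by left|by right| |].
    exact: iso_rho.
  by apply: rho_iso_D3; exact: card_G_gt0.
split; first by rewrite rho_cross; exact: golden_inverse.
split; first by rewrite rho_D3; exact: golden_inverse.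
exact: D3_not_cross_chorded.
Qed.
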